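(* Let $\boldsymbol u_h^0\in\mathbb V_h$ and $k>0$ be given. For each $n$, given $\boldsymbol u_h^n\in\mathbb V_h$, there exists a unique pair $(\boldsymbol u_h^{n+1},\boldsymbol H_h^{n+1})\in\mathbb V_h\times\mathbb V_h$ such that, for all $\boldsymbol\chi,\boldsymbol\phi\in\mathbb V_h$, $$\Big\langle\frac{\boldsymbol u_h^{n+1}-\boldsymbol u_h^n}{k},\boldsymbol\chi\Big\rangle=\lambda_r\langle\boldsymbol H_h^{n+1},\boldsymbol\chi\rangle+\lambda_e\langle\nabla\boldsymbol H_h^{n+1},\nabla\boldsymbol\chi\rangle-\gamma\langle\boldsymbol u_h^n\times\boldsymbol H_h^{n+1},\boldsymbol\chi\rangle,$$ $$\langle\boldsymbol H_h^{n+1},\boldsymbol\phi\rangle=-\langle\nabla\boldsymbol u_h^{n+1},\nabla\boldsymbol\phi\rangle+\kappa\mu\langle\boldsymbol u_h^n,\boldsymbol\phi\rangle-\kappa\langle|\boldsymbol u_h^{n+1}|^2\boldsymbol u_h^{n+1},\boldsymbol\phi\rangle-\beta\langle\boldsymbol e(\boldsymbol e\cdot\boldsymbol u_h^{n+1}),\boldsymbol\phi\rangle.$$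
   Context: $d\in\{1,2,3\}$; $\mathscr D\subset\mathbb R^d$ is a bounded domain, smooth or convex polygonal/polyhedral. $\mathbb H^1$ is the Sobolev space of $\mathbb R^3$-valued functions on $\mathscr D$; $\langle\cdot,\cdot\rangle$ is the $\mathbb L^2$ inner product (also for matrix-valued functions). Coefficients: $\lambda_r,\lambda_e,\kappa,\mu,\beta>0$, $\gamma\in\mathbb R$, $\boldsymbol e\in\mathbb R^3$ a fixed unit vector. $\mathbb V_h\subset\mathbb H^1$ is the finite-dimensional space of $\mathbb R^3$-valued continuous piecewise polynomials of degree at most $r\ge1$ on a triangulation of $\mathscr D$. *)

(* Defs.v *)
From HB Require Import structures.
From mathcomp Require Import all_boot all_order all_algebra.
From mathcomp Require Import all_classical all_reals all_analysis.
Import Order.TTheory GRing.Theory Num.Theory.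
Import numFieldNormedType.Exports.

Set Implicit Arguments.
Unset Strict Implicit.
Unset Printing Implicit Defensive.

Local Open Scope classical_set_scope.
Local Open Scope ring_scope.

(* The n-fold product of a sigma-finite measure, on the product sigma-algebra
   of n.-tuple T; the library only has binary products. *)

Section product_step.
Context {disp : measure_display} {T : measurableType disp} {R : realType}.
Variables (nu : {sigma_finite_measure set T -> \bar R}) (n : nat)
          (mu : {sigma_finite_measure set (n.-tuple T) -> \bar R}).

Definition tcons (p : T * n.-tuple T) : n.+1.-tuple T := [tuple of p.1 :: p.2].

Lemma measurable_tcons : measurable_fun setT tcons.
Proof. exact: measurable_cons. Qed.

Definition product_step (A : set (n.+1.-tuple T)) : \bar R :=
  (nu \x mu)%E (tcons @^-1` A).

Let product_step0 : product_step set0 = 0%E.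
Proof. by rewrite /product_step preimage_set0 measure0. Qed.

Let product_step_ge0 A : (0 <= product_step A)%E.
Proof. exact: measure_ge0. Qed.

Let product_step_sigma_additive : semi_sigma_additive product_step.
Proof.
move=> F mF tF mUF; rewrite /product_step preimage_bigcup.
have mtF k : measurable (tcons @^-1` F k).
  by rewrite -[X in measurable X]setTI; exact: measurable_tcons.
apply: measure_semi_sigma_additive => //.
- apply/trivIsetP => i j _ _ ij; rewrite -preimage_setI.
  by move/trivIsetP : tF => -> //; rewrite preimage_set0.
- exact: bigcupT_measurable.
Qed.

HB.instance Definition _ := isMeasure.Build _ _ _ product_step
  product_step0 product_step_ge0 product_step_sigma_additive.

Let product_step_sigma_finite : sigma_finite setT product_step.
Proof.
have /sigma_finiteP[F [TF ndF Foo]] := sigma_finiteT nu.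
have /sigma_finiteP[G [TG ndG Goo]] := sigma_finiteT mu.
pose g (t : n.+1.-tuple T) : T * n.-tuple T := (thead t, [tuple of behead t]).
have gK p : g (tcons p) = p.
  by case: p => x t; rewrite /g /tcons theadE; congr pair; exact/val_inj.
have mg : measurable_fun setT g.
  apply: measurable_fun_pair; first exact: measurable_tnth.
  exact: measurable_behead.
exists (fun k => g @^-1` (F k `*` G k)).
  apply/seteqP; split => // t _.
  have [i _ Fi] : (\bigcup_k F k) (thead t) by rewrite -TF.
  have [j _ Gj] : (\bigcup_k G k) [tuple of behead t] by rewrite -TG.
  exists (maxn i j) => //; split => /=.
    by move: Fi; exact/subsetPset/ndF/leq_maxl.
  by move: Gj; exact/subsetPset/ndG/leq_maxr.
move=> k; have [mFk Fk] := Foo k; have [mGk Gk] := Goo k; split.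
  by rewrite -[X in measurable X]setTI; apply: mg => //; exact: measurableX.
rewrite /product_step (_ : _ @^-1` _ = F k `*` G k); last first.
  by rewrite -comp_preimage (_ : g \o tcons = id) ?preimage_id//; exact/funext.
by rewrite product_measure1E// lte_mul_pinfty// ge0_fin_numE.
Qed.

HB.instance Definition _ := Measure_isSigmaFinite.Build _ _ _ product_step
  product_step_sigma_finite.

End product_step.

Section lebesgue.
Context {R : realType}.

Fixpoint lebesgue (d : nat) :
    {sigma_finite_measure set (d.-tuple (measurableTypeR R)) -> \bar R} :=
  if d is n.+1 then product_step (@lebesgue_measure R) (lebesgue n)
  else \d_([tuple] : 0.-tuple (measurableTypeR R)).

Lemma lebesgue_box (d : nat) (A : 'I_d -> set (measurableTypeR R)) :
  (forall i, measurable (A i)) ->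
  lebesgue d [set t | forall i, A i (tnth t i)] =
    (\prod_(i < d) lebesgue_measure (A i))%E.
Proof.
elim: d A => [|d IH] A mA.
  rewrite big_ord0 /= diracE mem_set//; by case.
rewrite big_ord_recl /= /product_step.
rewrite (_ : _ @^-1` _ =
    A ord0 `*` [set t | forall i, A (lift ord0 i) (tnth t i)]); last first.
  apply/seteqP; split => -[x t] /=.
    move=> h; split; first exact: (h ord0).
    by move=> i; have := h (lift ord0 i); rewrite tnthS.
  move=> [h0 h] i; case: (unliftP ord0 i) => [j|] ->; last exact: h0.
  by rewrite tnthS.
rewrite product_measure1E//; first by rewrite (IH (fun i => A (lift ord0 i))).
rewrite (_ : mkset _ = \bigcap_(i in [set: 'I_d])
   ((fun t : d.-tuple (measurableTypeR R) => tnth t i) @^-1` A (lift ord0 i))).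
  apply: fin_bigcap_measurable => // i _.
  by rewrite -[X in measurable X]setTI; exact: measurable_tnth.
by apply/seteqP; split => t /= h i; [move=> _|]; exact: h.
Qed.

End lebesgue.

(* Points of R^d are row vectors. Their library norm is the sup norm; it only
   serves the topology and boundedness. The Euclidean inner product of R^d and
   the Frobenius inner product of matrices are [mxdot]. *)

Section vectors.
Context {R : realType}.

Definition mxdot m n (A B : 'M[R]_(m, n)) : R :=
  \sum_(i < m) \sum_(j < n) A i j * B i j.

(* Indices are added modulo 3. *)
Definition crossp (u v : 'rV[R]_3) : 'rV[R]_3 :=
  \row_(i < 3) (u 0 (i + 1) * v 0 (i + 2) - u 0 (i + 2) * v 0 (i + 1)).

End vectors.

Section functions.
Context {R : realType} {d : nat}.
Implicit Types (D : set 'rV[R]_d) (f g phi : 'rV[R]_d -> R).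

Definition point_of (t : d.-tuple (measurableTypeR R)) : 'rV[R]_d :=
  \row_i tnth t i.

Definition integral_on D f : R :=
  \int[lebesgue d]_(t in point_of @^-1` D) f (point_of t).

Definition square_integrable D f : Prop :=
  measurable_fun (point_of @^-1` D) (f \o point_of) /\
  (lebesgue d).-integrable (point_of @^-1` D)
    (fun t => ((f (point_of t)) ^+ 2)%:E).

Definition partial (j : 'I_d) f : 'rV[R]_d -> R :=
  fun x => 'D_(delta_mx 0 j) f x.

(* C^oo: all iterated partial derivatives exist and are continuous. *)
Definition smooth f : Prop :=
  forall s : seq 'I_d,
    continuous (foldr partial f s) /\
    forall x (j : 'I_d), derivable (foldr partial f s) x (delta_mx 0 j).

Definition test_function D phi : Prop :=
  [/\ smooth phi,
      compact (closure [set x | phi x != 0]) &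
      closure [set x | phi x != 0] `<=` D].

(* Polynomial function of total degree at most r. *)
Definition poly_deg_le (r : nat) f : Prop :=
  exists c : {ffun 'I_d -> 'I_r.+1} -> R, forall x,
    f x = \sum_(a : {ffun 'I_d -> 'I_r.+1} | (\sum_i a i <= r)%N)
            c a * \prod_(i < d) x 0 i ^+ a i.

Definition L2inner D m n (F G : 'rV[R]_d -> 'M[R]_(m, n)) : R :=
  integral_on D (fun x => mxdot (F x) (G x)).

(* G is a square integrable weak gradient of v: G_ij represents the
   distributional derivative of v_i with respect to x_j on D. *)
Definition is_weak_gradient D (v : 'rV[R]_d -> 'rV[R]_3)
    (G : 'rV[R]_d -> 'M[R]_(3, d)) : Prop :=
  forall (i : 'I_3) (j : 'I_d),
    square_integrable D (fun x => G x i j) /\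
    forall phi, test_function D phi ->
      integral_on D (fun x => v x 0 i * partial j phi x) =
      - integral_on D (fun x => G x i j * phi x).

Definition H1 D (v : 'rV[R]_d -> 'rV[R]_3) : Prop :=
  (forall i, square_integrable D (fun x => v x 0 i)) /\
  exists G, is_weak_gradient D v G.

(* Defined up to a null set of D; junk (0) when v has no weak gradient. *)
Definition grad D (v : 'rV[R]_d -> 'rV[R]_3) : 'rV[R]_d -> 'M[R]_(3, d) :=
  xget (fun=> 0) [set G | is_weak_gradient D v G].

End functions.

Section meshes.
Context {R : realType} {d : nat}.
Implicit Types D : set 'rV[R]_d.

Definition bounded_domain D : Prop :=
  [/\ open D, connected D, bounded_set D & D !=set0].

(* D is locally a strict sublevel set of a regular smooth function. For open D,
   the boundary is closure D `\` D. *)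
Definition smooth_boundary D : Prop :=
  forall x, (closure D `\` D) x ->
    exists rho : 'rV[R]_d -> R,
      [/\ smooth rho, exists j, partial j rho x != 0 &
          \forall y \near x, D y <-> rho y < 0].

(* Finite intersection of open half-spaces. *)
Definition convex_polyhedral D : Prop :=
  exists (m : nat) (a : 'I_m -> 'rV[R]_d) (b : 'I_m -> R),
    D = [set x | forall i, mxdot (a i) x < b i].

(* Barycentric coordinates with respect to the vertices 0, e_1, .., e_d of the
   reference simplex. *)
Definition bary (x : 'rV[R]_d) (k : 'I_d.+1) : R :=
  if unlift ord0 k is Some i then x 0 i else 1 - \sum_i x 0 i.

(* The face of the reference simplex spanned by the vertices in I; it is empty
   when I is. *)
Definition ref_face (I : {pred 'I_d.+1}) : set 'rV[R]_d :=
  [set x | (forall k, 0 <= bary x k) /\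
           (forall k, k \notin I -> bary x k = 0)].

Definition ref_simplex : set 'rV[R]_d := ref_face predT.

Definition curved_simplex (F : 'rV[R]_d -> 'rV[R]_d) : Prop :=
  [/\ forall j, smooth (fun x => F x 0 j),
      {in ref_simplex &, injective F} &
      forall x, ref_simplex x -> 'J F x \in unitmx].

Definition straight_simplex (F : 'rV[R]_d -> 'rV[R]_d) : Prop :=
  exists (a : 'rV[R]_d) (B : 'M[R]_d),
    B \in unitmx /\ F = (fun x => a + x *m B).

(* The cells are the images F i @` ref_simplex. On a polyhedral domain they are
   straight simplices (intervals, triangles, tetrahedra). A domain with smooth
   boundary has no exact triangulation by straight simplices if d > 1, so
   smoothly curved simplices are admitted there. In both cases the mesh covers
   the closure of D and is conforming: two distinct cells meet in a common
   proper (possibly empty) face. *)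
Definition triangulation D (N : nat) (F : 'I_N -> 'rV[R]_d -> 'rV[R]_d) : Prop :=
  [/\ forall i, curved_simplex (F i),
      convex_polyhedral D -> forall i, straight_simplex (F i),
      \bigcup_i (F i @` ref_simplex) = closure D &
      forall i j, i != j -> exists I J : {pred 'I_d.+1},
        [/\ exists k, k \notin I, exists k, k \notin J,
            (F i @` ref_simplex) `&` (F j @` ref_simplex) = F i @` ref_face I &
            (F i @` ref_simplex) `&` (F j @` ref_simplex) = F j @` ref_face J]].

(* Elements are functions on the closure of D: their values elsewhere are
   irrelevant. Continuous piecewise polynomials always belong to H1; the first
   clause records V_h as a subspace of H1 and excludes nothing. *)
Definition fem_space D N (F : 'I_N -> 'rV[R]_d -> 'rV[R]_d) (r : nat)
    (v : 'rV[R]_d -> 'rV[R]_3) : Prop :=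
  [/\ H1 D v,
      {within closure D, continuous v} &
      forall (i : 'I_N) (c : 'I_3), exists2 p : 'rV[R]_d -> R,
        poly_deg_le r p &
        forall x, (F i @` ref_simplex) x -> v x 0 c = p x].

End meshes.

(* (u, H) solves one time step from un; V is the finite element space. *)
Definition scheme_step (R : realType) (d : nat) (D : set 'rV[R]_d)
    (V : ('rV[R]_d -> 'rV[R]_3) -> Prop)
    (lambda_r lambda_e kappa mu beta gamma : R) (e : 'rV[R]_3) (k : R)
    (un u H : 'rV[R]_d -> 'rV[R]_3) : Prop :=
  (forall chi, V chi ->
    L2inner D (fun x => k^-1 *: (u x - un x)) chi =
      lambda_r * L2inner D H chi
      + lambda_e * L2inner D (grad D H) (grad D chi)
      - gamma * L2inner D (fun x => crossp (un x) (H x)) chi) /\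
  (forall phi, V phi ->
    L2inner D H phi =
      - L2inner D (grad D u) (grad D phi)
      + kappa * mu * L2inner D un phi
      - kappa * L2inner D (fun x => mxdot (u x) (u x) *: u x) phi
      - beta * L2inner D (fun x => mxdot e (u x) *: e) phi).

(* Main.v *)
(* Eliminating the unknown H leaves, in coordinates with respect to an
   L^2-orthonormal basis of the finite element space, one equation T u = 0.
   With A the matrix of the coercive form
   lambda_r <H, chi> + lambda_e <grad H, grad chi> - gamma <u^n x H, chi>
   (the last term vanishes for chi = H), T is the sum of k^-1 (u - u^n) A^-1, of
   the stiffness and anisotropy terms and of the monotone cubic term. So T is a
   cubic polynomial map with positive definite derivative, and
   |u|^4 >= 2 |u|^2 - 1 makes it coercive. T is not a gradient, but
   |T u|^2 attains its minimum, and there T u = 0, since otherwise moving u in the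
   direction - T u would decrease |T u|^2. Uniqueness follows by testing the
   difference of two solutions with chi = dH and phi = du.

   The gradient being only some weak gradient, its linearity under the integral
   requires weak gradients to be unique almost everywhere: the indicator of an
   open box is a pointwise limit of smooth bumps prod_i f(n (x_i - l_i))
   f(n (u_i - x_i)) with f(x) = exp(-1/x), and orthants generate the measurable
   sets. *)

Require Import Defs.
From mathcomp Require Import all_boot all_order all_algebra.
From mathcomp Require Import all_classical all_reals all_analysis.
From mathcomp Require Import measurable_realfun ring lra.
Import Order.TTheory GRing.Theory Num.Theory.
Import numFieldNormedType.Exports.

Set Implicit Arguments.
Unset Strict Implicit.
Unset Printing Implicit Defensive.

Local Open Scope classical_set_scope.
Local Open Scope ring_scope.

(** * Lebesgue measure of open sets *)

Section lebesgue_measurability.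
Context {R : realType} {d : nat}.
Local Notation T := (d.-tuple (measurableTypeR R)).
Local Notation mu := (@lebesgue R d).
Implicit Types (l u : 'I_d -> R) (U : set 'rV[R]_d).

Definition openbox l u : set 'rV[R]_d :=
  [set x | forall i, l i < x 0 i < u i].

Lemma preimage_openbox l u : point_of @^-1` openbox l u =
  [set t : T | forall i, `]l i, u i[%classic (tnth t i)].
Proof.
apply/seteqP; split => t /= h i; have := h i; by rewrite ?mxE ?in_itv//= in_itv.
Qed.

Lemma measurable_pi (A : 'I_d -> set (measurableTypeR R)) :
  (forall i, measurable (A i)) -> measurable [set t : T | forall i, A i (tnth t i)].
Proof.
move=> mA; rewrite (_ : mkset _ = \bigcap_(i in [set: 'I_d])
    ((fun t : T => tnth t i) @^-1` A i)).
  apply: fin_bigcap_measurable => // i _.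
  by rewrite -[X in measurable X]setTI; exact: measurable_tnth.
by apply/seteqP; split => t /= h i; [move=> _|]; exact: h.
Qed.

Lemma measurable_openbox l u : measurable (point_of @^-1` openbox l u : set T).
Proof.
rewrite preimage_openbox.
by apply: (@measurable_pi (fun i => `]l i, u i[%classic)) => i; exact: measurable_itv.
Qed.

Lemma lebesgue_openbox l u : (forall i, l i < u i) ->
  mu (point_of @^-1` openbox l u) = (\prod_(i < d) (u i - l i))%:E.
Proof.
move=> lu; rewrite preimage_openbox.
rewrite (@lebesgue_box R d (fun i => `]l i, u i[%classic)); last first.
  by move=> i; exact: measurable_itv.
rewrite (big_morph EFin EFinM erefl); apply: eq_bigr => i _.
by rewrite lebesgue_measure_itv/= lte_fin lu -EFinB.
Qed.

(** Rational endpoints indexed by a finite function form a countable type, so unions over such boxes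
    are countable and [pickle] numbers them. *)
Definition ratbox (p : {ffun 'I_d -> rat * rat}) : set 'rV[R]_d :=
  openbox (fun i => ratr (p i).1) (fun i => ratr (p i).2).

Definition closedbox l u : set 'rV[R]_d :=
  [set x | forall i, l i <= x 0 i <= u i].

(** The topology is that of the sup norm, so a ball is a cube and rational endpoints fit between [x]
    and its faces. The closed box is placed inside [U] because bumps supported in it must later be
    test functions. *)
Lemma open_ratbox U x : open U -> U x -> exists p : {ffun 'I_d -> rat * rat},
  ratbox p x /\ closedbox (fun i => ratr (p i).1) (fun i => ratr (p i).2) `<=` U.
Proof.
move=> oU Ux; have /nbhs_ballP[e /= e0 eU] := open_nbhs_nbhs (conj oU Ux).
have H i : exists p : rat * rat,
    x 0 i - e < ratr p.1 < x 0 i /\ x 0 i < ratr p.2 < x 0 i + e.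
  have [|q1 h1] := @rat_in_itvoo R (x 0 i - e) (x 0 i); first lra.
  have [|q2 h2] := @rat_in_itvoo R (x 0 i) (x 0 i + e); first lra.
  by exists (q1, q2); move: h1 h2; rewrite !in_itv.
have [p hp] := choice H.
exists [ffun i => p i]; split.
  move=> i; rewrite !ffunE.
  by have [/andP[_ ->] /andP[-> _]] := hp i.
move=> y hy; apply: eU; split => // i j; rewrite ord1 /ball /= .
have := hy j; rewrite !ffunE; have [/andP[h1 h2] /andP[h3 h4]] := hp j.
by move=> /andP[h5 h6]; rewrite ltr_norml; lra.
Qed.

Lemma ratbox_closedbox p :
  ratbox p `<=` closedbox (fun i => ratr (p i).1) (fun i => ratr (p i).2).
Proof. by move=> x h i; have /andP[/ltW -> /ltW ->] := h i. Qed.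

Lemma open_bigcup_ratbox U : open U -> U =
  \bigcup_(p in [set p : {ffun 'I_d -> rat * rat} | closedbox (fun i => ratr (p i).1)
                                   (fun i => ratr (p i).2) `<=` U]) ratbox p.
Proof.
move=> oU; apply/seteqP; split => [x Ux|x [p pU px]].
  by have [p [px pU]] := open_ratbox oU Ux; exists p.
exact/pU/ratbox_closedbox.
Qed.

Lemma measurable_open_preimage U : open U -> measurable (point_of @^-1` U : set T).
Proof.
move=> oU; rewrite (open_bigcup_ratbox oU) preimage_bigcup.
set P := [set p | _].
(* The union over boxes is reindexed by their codes in [nat], to match closure under sequences; the
   family is empty at numbers that code no box. *)
rewrite (_ : \bigcup_(p in P) _ = \bigcup_(n in [set n | exists2 p, P p &
    unpickle n = Some p])
    (if unpickle n is Some p then point_of @^-1` ratbox p else set0)).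
  apply: bigcup_measurable => n _; case: unpickle => // p.
  exact: measurable_openbox.
apply/seteqP; split => [t [p Pp pt]|t [n [p Pp ->] pt]].
  by exists (pickle p); [exists p; rewrite ?pickleK|rewrite pickleK].
by exists p.
Qed.

Lemma measurable_continuous (f : 'rV[R]_d -> R) : continuous f ->
  measurable_fun setT (f \o (@point_of R d)).
Proof.
move=> /continuousP cf.
apply: (measurability _ (RGenOpens.measurableE R)) => _ [_ [a [b ->]] <-].
rewrite setTI comp_preimage; apply: measurable_open_preimage.
by apply: cf.
Qed.

Lemma bounded_lebesgue_fin U : open U -> bounded_set U ->
  (mu (point_of @^-1` U) < +oo)%E.
Proof.
move=> oU [M [_ hM]].
(* [bounded_set] bounds the norm only by numbers strictly above [M], such as [|M| + 1]; the second
   unit makes the inequalities of the open box strict. *)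
pose B := openbox (fun=> - (`|M| + 2)) (fun=> `|M| + 2).
have UB : U `<=` B.
  move=> x Ux i; have Mx : `|x| <= `|M| + 1.
    by apply: (hM (`|M| + 1)) Ux; have := ler_norm M; lra.
  have : `|x 0 i| <= `|x|.
    rewrite [leRHS]/Num.norm/= mx_normrE.
    by apply/bigmax_geP; right => /=; exists (0, i).
  move=> xi; rewrite -ltr_norml; lra.
apply: (@le_lt_trans _ _ (mu (point_of @^-1` B))).
  apply: le_measure; rewrite ?inE; [exact: measurable_open_preimage| |].
    exact: measurable_openbox.
  by move=> t /UB.
by rewrite lebesgue_openbox ?ltry// => i; have := normr_ge0 M; lra.
Qed.

Lemma open_lebesgue_gt0 U : open U -> U !=set0 ->
  (0 < mu (point_of @^-1` U))%E.
Proof.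
move=> oU [x Ux]; have [p [px pU]] := open_ratbox oU Ux.
apply: (@lt_le_trans _ _ (mu (point_of @^-1` ratbox p))).
  rewrite lebesgue_openbox ?lte_fin.
    apply: prodr_gt0 => i _; rewrite subr_gt0.
    by have /andP[] := px i; exact: lt_trans.
  by move=> i; have /andP[] := px i; exact: lt_trans.
apply: le_measure; rewrite ?inE; [exact: measurable_openbox| |].
  exact: measurable_open_preimage.
by move=> t /ratbox_closedbox/pU.
Qed.

Definition upper_orthant (a : 'I_d -> R) : set T :=
  [set t | forall i, a i < tnth t i].

Lemma measurable_upper_orthant a : measurable (upper_orthant a).
Proof.
rewrite (_ : upper_orthant a =
    [set t | forall i, `]a i, +oo[%classic (tnth t i)]).
  apply: (@measurable_pi (fun i => `]a i, +oo[%classic)) => i; exact: measurable_itv.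
by apply/seteqP; split => t h i; have := h i; rewrite /= in_itv/= andbT.
Qed.

(** It suffices that coordinates are measurable for the sigma-algebra generated by orthants: a
    half-space bounding one coordinate from below is the union of orthants whose other corner
    coordinates tend to minus infinity. *)
Lemma measurable_upper_orthantE :
  @measurable _ T = <<s range upper_orthant >>.
Proof.
apply/seteqP; split; last first.
  apply: smallest_sub; first exact: sigma_algebra_measurable.
  by move=> _ [a _ <-]; exact: measurable_upper_orthant.
pose G := range upper_orthant.
pose S : measurableType _ := g_sigma_algebraType G.
suff mt i : measurable_fun [set: S] (fun t : S => tnth (t : T) i).
  apply: smallest_sub; first exact: smallest_sigma_algebra.
  move=> A; rewrite -bigcup_seq/= => -[i _ [B mB <-]].
  by have := mt i measurableT B mB.
apply: (measurability _ (RGenOInfty.measurableE R)) => _ [_ [a ->] <-].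
rewrite setTI.
pose b (n : nat) (j : 'I_d) := if j == i then a else - n%:R : R.
rewrite (_ : _ @^-1` _ = \bigcup_n upper_orthant (b n)).
  by apply: bigcupT_measurable => n; apply: sub_sigma_algebra; exists (b n).
apply/seteqP; split => t /=; rewrite in_itv/= andbT.
  move=> at_; pose M := \sum_j `|tnth t j|.
  (* This index exceeds the sum of the absolute values of all coordinates, so its opposite lies
     below each of them. *)
  exists (Num.truncn M).+1 => // j; rewrite /b; case: eqP => [->//|_].
  have := truncnS_gt M; have : `|tnth t j| <= M.
    by rewrite /M (bigD1 j)//= lerDl sumr_ge0.
  by have := ler_norm (- tnth t j : R); rewrite normrN; lra.
by move=> [n _] /(_ i); rewrite /b eqxx.
Qed.

(** Taking maxima of corners shows that orthants form a pi-system, as Dynkin induction requires. *)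
Lemma setI_closed_upper_orthant : setI_closed (range upper_orthant).
Proof.
move=> _ _ [a _ <-] [b _ <-]; exists (fun i => Num.max (a i) (b i)) => //.
apply/seteqP; split => t; last first.
  by move=> [h1 h2] i; rewrite gt_max h1 h2.
by move=> h; split => i; have := h i; rewrite gt_max => /andP[].
Qed.

End lebesgue_measurability.

(** * Inner products and coercive monotone systems *)

Section mxdot_theory.
Context {R : realType} {m n : nat}.
Implicit Types A B C : 'M[R]_(m, n).

Lemma mxdotC A B : mxdot A B = mxdot B A.
Proof. by do 2!apply: eq_bigr => ? _; rewrite mulrC. Qed.

Lemma mxdotDl A B C : mxdot (A + B) C = mxdot A C + mxdot B C.
Proof.
rewrite /mxdot -big_split; apply: eq_bigr => i _; rewrite -big_split.
by apply: eq_bigr => j _; rewrite mxE mulrDl.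
Qed.

Lemma mxdotZl a A B : mxdot (a *: A) B = a * mxdot A B.
Proof.
rewrite /mxdot mulr_sumr; apply: eq_bigr => i _; rewrite mulr_sumr.
by apply: eq_bigr => j _; rewrite mxE mulrA.
Qed.

Lemma mxdotDr A B C : mxdot A (B + C) = mxdot A B + mxdot A C.
Proof. by rewrite mxdotC mxdotDl !(mxdotC _ A). Qed.

Lemma mxdotZr a A B : mxdot A (a *: B) = a * mxdot A B.
Proof. by rewrite mxdotC mxdotZl mxdotC. Qed.

Lemma mxdotNl A B : mxdot (- A) B = - mxdot A B.
Proof. by rewrite -scaleN1r mxdotZl mulN1r. Qed.

Lemma mxdotNr A B : mxdot A (- B) = - mxdot A B.
Proof. by rewrite mxdotC mxdotNl mxdotC. Qed.

Lemma mxdotBl A B C : mxdot (A - B) C = mxdot A C - mxdot B C.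
Proof. by rewrite mxdotDl mxdotNl. Qed.

Lemma mxdotBr A B C : mxdot A (B - C) = mxdot A B - mxdot A C.
Proof. by rewrite mxdotDr mxdotNr. Qed.

Lemma mxdot0l B : mxdot 0 B = 0.
Proof. by rewrite -(scale0r 0) mxdotZl mul0r. Qed.

Lemma mxdot0r B : mxdot B 0 = 0.
Proof. by rewrite mxdotC mxdot0l. Qed.

Lemma mxdot_ge0 A : 0 <= mxdot A A.
Proof. by do 2!apply: sumr_ge0 => ? _; rewrite -expr2 sqr_ge0. Qed.

Lemma sqr_le_mxdot A i j : A i j ^+ 2 <= mxdot A A.
Proof.
rewrite /mxdot (bigD1 i)//= (bigD1 j)//= -expr2 -addrA lerDl addr_ge0//.
  by apply: sumr_ge0 => ? _; rewrite -expr2 sqr_ge0.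
by do 2!apply: sumr_ge0 => ? _; rewrite -expr2 sqr_ge0.
Qed.

Lemma mxdot_eq0 A : mxdot A A = 0 -> A = 0.
Proof.
move=> A0; apply/matrixP => i j; rewrite mxE.
have := sqr_le_mxdot A i j; rewrite A0 => h.
by apply/eqP; rewrite -sqrf_eq0 eq_le h sqr_ge0.
Qed.

Lemma mxdot_gt0 A : A != 0 -> 0 < mxdot A A.
Proof.
move=> A0; rewrite lt_neqAle mxdot_ge0 andbT eq_sym.
by apply: contra A0 => /eqP/mxdot_eq0 ->.
Qed.

End mxdot_theory.

Lemma continuous_sum {R : realType} (T : topologicalType) (I : Type) (s : seq I)
    (f : I -> T -> R) :
  (forall i, continuous (f i)) -> continuous (fun x => \sum_(i <- s) f i x).
Proof.
move=> cf; elim: s => [|i s ih] x.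
  by under eq_fun do rewrite big_nil; exact: cvg_cst.
under eq_fun do rewrite big_cons.
by apply: cvgD; [exact: cf|exact: ih].
Qed.

Lemma continuous_prod {R : realType} (T : topologicalType) (I : Type) (s : seq I)
    (f : I -> T -> R) :
  (forall i, continuous (f i)) -> continuous (fun x => \prod_(i <- s) f i x).
Proof.
move=> cf; elim: s => [|i s ih] x.
  by under eq_fun do rewrite big_nil; exact: cvg_cst.
under eq_fun do rewrite big_cons.
by apply: cvgM; [exact: cf|exact: ih].
Qed.

Lemma cvg_bigprod {R : realType} (I : Type) (s : seq I) (f : I -> nat -> R)
    (l : I -> R) : (forall i, f i n @[n --> \oo] --> l i) ->
  \prod_(i <- s) f i n @[n --> \oo] --> \prod_(i <- s) l i.
Proof.
move=> cf; elim: s => [|i s ih].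
  by rewrite big_nil; under eq_fun do rewrite big_nil; exact: cvg_cst.
rewrite big_cons; under eq_fun do rewrite big_cons.
by apply: cvgM; [exact: cf|exact: ih].
Qed.

Definition mxdotE := (@mxdotDl, @mxdotDr, @mxdotZl, @mxdotZr, @mxdotNl, @mxdotNr,
  @mxdot0l, @mxdot0r).

(** * Linear functionals, coercive cubic maps and bilinear forms on a Euclidean space *)

Section euclidean_space.
Context {R : realType} {m : nat}.
Local Notation E := 'rV[R]_m.
Implicit Types (l : E -> R) (f : E -> E -> R).

Definition lin l := forall a x y, l (a *: x + y) = a * l x + l y.

Lemma lin0 l : lin l -> l 0 = 0.
Proof. by move=> h; have := h (-1) 0 0; rewrite scaler0 addr0 mulN1r addNr. Qed.

Lemma linZ l : lin l -> forall a x, l (a *: x) = a * l x.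
Proof. by move=> h a x; have := h a x 0; rewrite !addr0 (lin0 h) addr0. Qed.

Lemma linD l : lin l -> forall x y, l (x + y) = l x + l y.
Proof. by move=> h x y; have := h 1 x y; rewrite scale1r mul1r. Qed.

Lemma lin_sum l (I : Type) (s : seq I) (P : pred I) (G : I -> E) : lin l ->
  l (\sum_(i <- s | P i) G i) = \sum_(i <- s | P i) l (G i).
Proof.
by move=> h; apply: (big_morph l); [exact: linD|exact: lin0].
Qed.

Local Notation basis i := (delta_mx 0 i : E).

Lemma lin_coord l x : lin l -> l x = \sum_i x 0 i * l (basis i).
Proof.
move=> h; rewrite {1}(row_sum_delta x) lin_sum//.
by apply: eq_bigr => i _; rewrite linZ.
Qed.

Definition riesz l : E := \row_j l (basis j).

Lemma mxdot_riesz l x : lin l -> mxdot (riesz l) x = l x.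
Proof.
move=> h; rewrite /mxdot big_ord1 (lin_coord x h).
by apply: eq_bigr => j _; rewrite mxE mulrC.
Qed.

Lemma continuous_coord_sum (c : 'I_m -> E -> R) : (forall i, continuous (c i)) ->
  continuous (fun x : E => \sum_i x 0 i * c i x).
Proof.
move=> hc; apply: (@continuous_sum R E) => i x.
by apply: continuousM; [exact: coord_continuous|exact: hc].
Qed.

Lemma lin_continuous l : lin l -> continuous l.
Proof.
move=> h; rewrite (_ : l = fun x => \sum_i x 0 i * l (basis i)).
  by apply: continuous_coord_sum => i; exact: cst_continuous.
by apply/funext => x; exact: lin_coord.
Qed.

Lemma compact_euclidean_ball (rho : R) :
  compact [set x : E | mxdot x x <= rho].
Proof.
apply: bounded_closed_compact.
  exists (Num.sqrt rho); split; first exact: num_real.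
  move=> M hM x /= hx; rewrite [leLHS]/Num.norm/= mx_normrE.
  have M0 : 0 <= M by exact: le_trans (sqrtr_ge0 _) (ltW hM).
  apply/bigmax_leP; split => // -[i j] _ /=.
  rewrite -ler_sqr ?nnegrE//  real_normK ?num_real//.
  apply: le_trans (sqr_le_mxdot x i j) (le_trans hx _).
  rewrite -(ler_sqrt _ (sqr_ge0 M)) sqrtr_sqr ger0_norm//; exact: ltW.
rewrite (_ : mkset _ = (fun x : E => mxdot x x) @^-1` [set y | y <= rho])//.
apply: preimage_closed; last exact: closed_le.
move=> x _; rewrite (_ : (fun y => _) = fun y : E => \sum_i y 0 i * y 0 i).
  by apply: continuous_coord_sum => i; exact: coord_continuous.
by apply/funext => y; rewrite /mxdot big_ord1.
Qed.

(** The last hypothesis is the Taylor expansion of a cubic map along [v]: [p1] is the derivative at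
    [x] applied to [v], and [0 < mxdot v p1] says that this derivative is positive definite. With
    [v = - T x] it makes [- T x] a descent direction of the squared norm of [T] wherever [T x] is
    nonzero. *)
Lemma coercive_monotone_zero (T : E -> E) (c K : R) : 0 < c ->
  (forall j, continuous (fun x => T x 0 j)) ->
  (forall x, 2 * c * mxdot x x - K <= mxdot x (T x - T 0)) ->
  (forall x v, v != 0 -> exists p1 p2 p3 : E, 0 < mxdot v p1 /\
     forall t, T (x + t *: v) =
       T x + t *: p1 + t ^+ 2 *: p2 + t ^+ 3 *: p3) ->
  exists x, T x = 0.
Proof.
move=> c0 cT coer mono.
pose f x := mxdot (T x) (T x).
have cf : continuous f.
  rewrite /f (_ : (fun y => _) = fun y => \sum_i T y 0 i * T y 0 i).
    apply: (@continuous_sum R E) => i {}x.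
    by apply: continuousM; exact: cT.
  by apply/funext => y; rewrite /mxdot big_ord1.
(* Young's inequality with weight [c] bounds both [mxdot x (T x)] and [- mxdot x (T 0)] by
   [c / 2 * mxdot x x] plus a squared norm over [2 * c]. If [f x <= f 0], coercivity then leaves
   [c * mxdot x x <= K + c^-1 * f 0]. *)
pose rho := (K + c^-1 * f 0) / c.
have bnd x : f x <= f 0 -> mxdot x x <= rho.
  move=> fx.
  have h1 : 0 <= mxdot (c *: x - T x) (c *: x - T x) by exact: mxdot_ge0.
  have h2 : 0 <= mxdot (c *: x + T 0) (c *: x + T 0) by exact: mxdot_ge0.
  have h3 := coer x.
  rewrite !mxdotE (mxdotC (T x) x) in h1; rewrite !mxdotE (mxdotC (T 0) x) in h2.
  rewrite !mxdotE in h3.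
  rewrite /rho ler_pdivlMr// -(ler_pM2l c0) mulrDr mulVKf ?gt_eqF//.
  rewrite /f in fx *; have h4 := ler_wpM2l (ltW c0) h3.
  rewrite mulrBr in h4; nra.
have rho0 : 0 <= rho by have := bnd 0 (lexx _); rewrite mxdot0l.
have [|||x _ xmin] := @EVT_min_rV R m f [set x : E | mxdot x x <= rho].
- by exists 0; rewrite /= mxdot0l.
- exact: compact_euclidean_ball.
- exact: continuous_subspaceT.
(* Outside the ball [f] exceeds [f 0], so the minimum over the compact ball is global. *)
have {}xmin y : f x <= f y.
  have [yr|yr] := leP (mxdot y y) rho; first by apply: xmin; rewrite inE.
  have f0y : f 0 <= f y.
    by rewrite leNgt; apply/negP => /ltW/bnd; rewrite leNgt yr.
  by apply: le_trans f0y; apply: xmin; rewrite inE /= mxdot0l.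
exists x; apply/eqP/negPn/negP => r0.
have [|p1 [p2 [p3 [vp1 Tt]]]] := mono x (- T x); first by rewrite oppr_eq0.
rewrite mxdotNl oppr_gt0 in vp1.
set r := T x in vp1 Tt r0.
(* With [a = mxdot r p1], the increment [f (x - t *: r) - f x] equals [t * (2 * a + t * W)], where
   [W] collects the higher coefficients and [B] bounds [W] for [t] between [0] and [1]. The choice
   of [t] gives [t * B <= - a], so the increment is at most [t * a < 0]; the [+ 1] in the
   denominator covers [B = 0]. *)
pose B := `|2 * mxdot r p2| + mxdot p1 p1 + `|2 * mxdot r p3| +
  `|2 * mxdot p1 p2| + `|2 * mxdot p1 p3| + mxdot p2 p2 +
  `|2 * mxdot p2 p3| + mxdot p3 p3.
have [[pp1 pp2] pp3] := (mxdot_ge0 p1, mxdot_ge0 p2, mxdot_ge0 p3).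
have B0 : 0 <= B by rewrite /B !addr_ge0.
set a := mxdot r p1 in vp1.
pose t := Num.min 1 (- a / (B + 1)).
have t0 : 0 < t by rewrite lt_min ltr01/= divr_gt0 ?oppr_gt0// ltr_wpDl.
have t1 : t <= 1 by rewrite ge_min lexx.
have tB : t * B <= - a.
  have : t <= - a / (B + 1) by rewrite ge_min lexx orbT.
  by rewrite ler_pdivlMr ?ltr_wpDl// mulrDr mulr1; lra.
have := xmin (x + t *: - r); rewrite /f Tt -/r !mxdotE.
rewrite (mxdotC p1 r) (mxdotC p2 r) (mxdotC p3 r) (mxdotC p2 p1) (mxdotC p3 p1)
  (mxdotC p3 p2) -/a.
have lem (z : R) (n : nat) : t ^+ n * z <= `|z|.
  apply: le_trans (ler_norm _) _; rewrite normrM ler_piMl// ger0_norm.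
    by rewrite exprn_ile1// ltW.
  by rewrite exprn_ge0// ltW.
have := lem (2 * mxdot r p2) 0; have := lem (mxdot p1 p1) 0.
have := lem (2 * mxdot r p3) 1; have := lem (2 * mxdot p1 p2) 1.
have := lem (2 * mxdot p1 p3) 2; have := lem (mxdot p2 p2) 2.
have := lem (2 * mxdot p2 p3) 3; have := lem (mxdot p3 p3) 4.
rewrite (ger0_norm pp1) (ger0_norm pp2) (ger0_norm pp3) !expr0 expr1 !mul1r.
move=> l1 l2 l3 l4 l5 l6 l7 l8 fin.
pose W := 2 * mxdot r p2 + mxdot p1 p1 + t * (2 * mxdot r p3) +
  t * (2 * mxdot p1 p2) + t ^+ 2 * (2 * mxdot p1 p3) + t ^+ 2 * mxdot p2 p2 +
  t ^+ 3 * (2 * mxdot p2 p3) + t ^+ 4 * mxdot p3 p3.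
have WB : W <= B by rewrite /W /B; lra.
have : 0 <= t * (2 * a + t * W) by rewrite /W; lra.
rewrite pmulr_rge0// leNgt => /negP; apply.
have := ler_wpM2l (ltW t0) WB; lra.
Qed.

Definition bilin f := (forall z, lin (f ^~ z)) /\ (forall x, lin (f x)).

Definition form_mx f : 'M[R]_m := \matrix_(i, j) f (basis i) (basis j).

Lemma mxdot_form_mx f x y : bilin f -> mxdot (x *m form_mx f) y = f x y.
Proof.
move=> [fl fr]; rewrite (lin_coord y (fr x)) /mxdot big_ord1.
apply: eq_bigr => j _; rewrite mulrC (lin_coord x (fl _)); congr *%R.
by rewrite mxE; apply: eq_bigr => i _; rewrite mxE.
Qed.

(** A nonzero row vector [v] in the kernel of the matrix would give [f v v = 0]. *)
Lemma positive_form_unitmx f : bilin f ->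
  (forall x, x != 0 -> 0 < f x x) -> form_mx f \in unitmx.
Proof.
move=> bf pf; rewrite -row_free_unit; apply: inj_row_free => v v0.
apply/eqP/negPn/negP => /pf.
by rewrite -mxdot_form_mx// v0 mxdot0l ltxx.
Qed.

End euclidean_space.

(** * The algebraic system of one time step in coordinates *)

Section nonlinear_system.
Context {R : realType} {m : nat}.
Local Notation E := 'rV[R]_m.
Variables (k lr le kappa mu beta gamma K : R).
Hypotheses (k0 : 0 < k) (lr0 : 0 < lr) (le0 : 0 < le) (kappa0 : 0 < kappa)
  (beta0 : 0 < beta).
Variables (s c b : E -> E -> R) (tau : E -> E -> E -> E -> R) (l0 : E -> R).
Hypotheses (bs : bilin s) (bc : bilin c) (bb : bilin b) (ll0 : lin l0).
Hypotheses (tau1 : forall y z w, lin (fun x => tau x y z w))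
  (tau2 : forall x z w, lin (fun y => tau x y z w))
  (tau3 : forall x y w, lin (fun z => tau x y z w))
  (tau4 : forall x y z, lin (tau x y z)).
Hypotheses (s_ge0 : forall x, 0 <= s x x) (c_eq0 : forall x, c x x = 0)
  (b_ge0 : forall x, 0 <= b x x).
Hypotheses (tauC : forall x y z w, tau x y z w = tau y x z w)
  (tau_ge0 : forall x y, 0 <= tau x x y y)
  (tau_sq_ge0 : forall x y, 0 <= tau x y x y)
  (tau_coercive : forall x, 2 * mxdot x x - K <= tau x x x x).

(** The parameters are coordinate versions of the terms of the scheme: [s] is the stiffness form,
    [c] the cross product with the previous step, [b] the anisotropy, [tau] the quadrilinear form
    behind the cubic term and [l0] the pairing with the previous step. The form [a] is the
    right-hand side of the first equation; its last term vanishes on the diagonal by [c_eq0]. *)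
Let a (y z : E) := lr * mxdot y z + le * s y z - gamma * c y z.

Let ba : bilin a.
Proof.
split=> z t x y; rewrite /a !mxdotE.
  by rewrite (bs.1 z t x y) (bc.1 z t x y); ring.
by rewrite (bs.2 z t x y) (bc.2 z t x y); ring.
Qed.

Let a_gt0 y : y != 0 -> 0 < a y y.
Proof.
move=> y0; rewrite /a c_eq0 mulr0 subr0 ltr_wpDr//.
  by rewrite mulr_ge0// ltW.
by rewrite mulr_gt0// mxdot_gt0.
Qed.

Let A := form_mx a.

Let uA : A \in unitmx. Proof. exact: positive_form_unitmx. Qed.

(** Writing [x = w *m A] turns the quantity into [a w w]. *)
Let invA_gt0 (x : E) : x != 0 -> 0 < mxdot x (x *m invmx A).
Proof.
move=> x0; set w := x *m invmx A.
have xw : x = w *m A by rewrite mulmxKV.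
rewrite {1}xw mxdot_form_mx// a_gt0//.
by apply: contra x0 => /eqP w0; rewrite xw w0 mul0mx.
Qed.

(** The second equation reads [mxdot y z = - g x z]. *)
Let g x z := s x z + beta * b x z + kappa * tau x x x z - kappa * mu * l0 z.

Let lg x : lin (g x).
Proof.
move=> t y z; rewrite /g (bs.2 x t y z) (bb.2 x t y z) (tau4 x x x t y z) ll0.
by ring.
Qed.

(** The first summand is the [y] that the first equation determines from [x]; [T x = 0] is then the
    second equation for all [z] at once. *)
Let T x := k^-1 *: ((x - riesz l0) *m invmx A) + riesz (g x).

Let continuous_T j : continuous (fun x : E => T x 0 j).
Proof.
pose e : E := delta_mx 0 j.
have l1 : lin (fun x : E => (x *m invmx A) 0 j).
  by move=> t x y; rewrite mulmxDl -scalemxAl !mxE.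
have h1 := lin_continuous l1.
have h2 := lin_continuous (bs.1 e).
have h3 := lin_continuous (bb.1 e).
have h4 : continuous (fun x => tau x x x e).
  rewrite (_ : (fun x => _) = fun x : E => \sum_i x 0 i * \sum_i1 x 0 i1 *
      \sum_i2 x 0 i2 * tau (delta_mx 0 i) (delta_mx 0 i1) (delta_mx 0 i2) e).
    do 3!(apply: continuous_coord_sum => ?).
    exact: cst_continuous.
  apply/funext => x; rewrite (lin_coord x (tau1 x x e)); apply: eq_bigr => i _.
  rewrite (lin_coord x (tau2 _ x e)); congr *%R; apply: eq_bigr => i1 _.
  by rewrite (lin_coord x (tau3 _ _ e)).
rewrite (_ : (fun x => _) = fun x => k^-1 * ((x *m invmx A) 0 j) -
    k^-1 * (riesz l0 *m invmx A) 0 j +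
    (s x e + beta * b x e + kappa * tau x x x e - kappa * mu * l0 e)); last first.
  by apply/funext => x; rewrite /T mulmxBl !mxE mulrBr.
have hZ (t : R) (f : E -> R) : continuous f -> continuous (fun x => t * f x).
  by move=> cf x; apply: continuousM; [exact: cst_continuous|exact: cf].
have hD (f h : E -> R) :
    continuous f -> continuous h -> continuous (fun x => f x + h x).
  by move=> cf ch x; exact: (continuousD (cf x) (ch x)).
apply: (hD); first by apply: (hD); [exact: (hZ)|exact: cst_continuous].
apply: (hD); last exact: cst_continuous.
by apply: (hD); [apply: (hD); [exact: h2|exact: (hZ)]|exact: (hZ)].
Qed.

Let mxdot_T x y : mxdot y (T x) =
  k^-1 * mxdot y (x *m invmx A) - k^-1 * mxdot y (riesz l0 *m invmx A) + g x y.
Proof.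
by rewrite /T mulmxBl !mxdotE mulrBr (mxdotC _ (riesz (g x))) mxdot_riesz.
Qed.

(** Subtracting [T 0] cancels the contributions of [l0]. The inverse of [A], the stiffness and the
    anisotropy give nonnegative terms, and [tau_coercive] multiplied by [kappa] supplies the
    growth. *)
Let T_coercive x : 2 * kappa * mxdot x x - kappa * K <= mxdot x (T x - T 0).
Proof.
rewrite mxdotBr !mxdot_T mul0mx mxdot0r mulr0 /g.
rewrite (lin0 (bs.1 x)) (lin0 (bb.1 x)) (lin0 (tau1 0 0 x)).
have := ler_wpM2l (ltW kappa0) (tau_coercive x).
have : 0 <= k^-1 * mxdot x (x *m invmx A).
  have [->|x0] := eqVneq x 0; first by rewrite mxdot0l mulr0.
  by rewrite mulr_ge0 ?invr_ge0 ?ltW// invA_gt0.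
have := s_ge0 x; have := mulr_ge0 (ltW beta0) (b_ge0 x); lra.
Qed.

(** [q1], [q2] and [q3] collect the terms of degree one, two and three in [v] of [g (x + t *: v)].
    Strict positivity comes from [v *m invmx A]; at [z = v] the [tau] terms of [q1] become two
    copies of [tau x v x v] and one [tau x x v v], all nonnegative. *)
Let T_expand x v : v != 0 -> exists p1 p2 p3 : E, 0 < mxdot v p1 /\
   forall t, T (x + t *: v) = T x + t *: p1 + t ^+ 2 *: p2 + t ^+ 3 *: p3.
Proof.
move=> v0.
pose q1 z := s v z + beta * b v z +
  kappa * (tau v x x z + tau x v x z + tau x x v z).
pose q2 z := kappa * (tau v v x z + tau v x v z + tau x v v z).
pose q3 z := kappa * tau v v v z.
have lq1 : lin q1.
  move=> t y z; rewrite /q1 (bs.2 v t y z) (bb.2 v t y z).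
  by rewrite (tau4 v x x t y z) (tau4 x v x t y z) (tau4 x x v t y z); ring.
exists (k^-1 *: (v *m invmx A) + riesz q1), (riesz q2), (riesz q3); split.
  rewrite !mxdotE (mxdotC v (riesz _)) mxdot_riesz//.
  rewrite ltr_wpDr ?mulr_gt0 ?invr_gt0 ?invA_gt0//
    /q1 (tauC v x x v).
  apply: addr_ge0; first by rewrite addr_ge0// mulr_ge0// ltW.
  by rewrite (mulr_ge0 (ltW kappa0))// addr_ge0// addr_ge0.
move=> t; apply/rowP => j; rewrite /T !mulmxBl mulmxDl -scalemxAl !mxE.
set e : E := delta_mx 0 j; rewrite /g /q1 /q2 /q3 !(addrC x (t *: v)).
rewrite (bs.1 e t v x) (bb.1 e t v x) tau1 !tau2 !tau3.
by ring.
Qed.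

Lemma nonlinear_system_solvable : exists x y : E,
  (forall z, k^-1 * (mxdot x z - l0 z) =
     lr * mxdot y z + le * s y z - gamma * c y z) /\
  (forall z, mxdot y z = - s x z + kappa * mu * l0 z
     - kappa * tau x x x z - beta * b x z).
Proof.
have [x Tx] := coercive_monotone_zero kappa0 continuous_T T_coercive T_expand.
exists x, (k^-1 *: ((x - riesz l0) *m invmx A)); split=> z.
  apply: eq_trans (mxdot_form_mx _ z ba).
  by rewrite -scalemxAl mulmxKV// mxdotZl mxdotBl mxdot_riesz.
have := mxdot_T x z; rewrite Tx mxdot0r /g mxdotZl mulmxBl mxdotBl.
by rewrite (mxdotC _ z) (mxdotC _ z) mulrBr; lra.
Qed.

End nonlinear_system.

(** * Smooth bump functions *)

Section smooth_real_functions.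
Context {R : realType}.
Implicit Types (f g : R -> R) (n : nat).

Fixpoint deriv_n n f : Prop :=
  if n is n'.+1 then (forall x, derivable f x 1) /\ deriv_n n' (derive1 f) else True.

Definition Cinfty f := forall n, deriv_n n f.

Lemma deriv_nS n f : deriv_n n.+1 f -> deriv_n n f.
Proof. by elim: n f => // n ih f [df /ih]. Qed.

Lemma Cinfty_derivable f x : Cinfty f -> derivable f x 1.
Proof. by move=> /(_ 1%N)[]. Qed.

Lemma Cinfty_derive1 f : Cinfty f -> Cinfty (derive1 f).
Proof. by move=> Cf n; have [] := Cf n.+1. Qed.

Lemma Cinfty_continuous f : Cinfty f -> continuous f.
Proof.
by move=> Cf x; apply/differentiable_continuous/derivable1_diffP/Cinfty_derivable.
Qed.

Lemma deriv_nD n f g : deriv_n n f -> deriv_n n g ->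
  deriv_n n (fun x => f x + g x).
Proof.
elim: n f g => // n ih f g [df ddf] [dg ddg]; split=> [x|].
  exact: derivableD.
rewrite (_ : derive1 _ = fun x => derive1 f x + derive1 g x); first exact: ih.
by apply/funext => x; rewrite derive1E (deriveD (df x) (dg x)) !derive1E.
Qed.

(** The derivative of a product contains the undifferentiated factors, which [deriv_nS] lowers to
    the order of the induction hypothesis. *)
Lemma deriv_nM n f g : deriv_n n f -> deriv_n n g ->
  deriv_n n (fun x => f x * g x).
Proof.
elim: n f g => // n ih f g /[dup] ff [df ddf] /[dup] gg [dg ddg]; split=> [x|].
  exact: derivableM.
rewrite (_ : derive1 _ = fun x => f x * derive1 g x + g x * derive1 f x).
  by apply: deriv_nD; apply: ih => //; exact: deriv_nS.
by apply/funext => x; rewrite derive1E (deriveM (df x) (dg x)) !derive1E.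
Qed.

Lemma deriv_n_cst n (c : R) : deriv_n n (fun=> c).
Proof.
elim: n c => // n ih c; split=> [x|]; first exact: derivable_cst.
rewrite (_ : derive1 _ = fun=> 0); first exact: ih.
by apply/funext => x; rewrite derive1_cst.
Qed.

Lemma deriv_n_affine n f (a b : R) : deriv_n n f ->
  deriv_n n (fun x => f (a * x + b)).
Proof.
have aff (x : R) : is_derive x 1 (fun x => a * x + b) a.
  by apply: is_derive_eq; rewrite addr0 scaler1.
elim: n f => // n ih f [df ddf].
have H (x : R) : is_derive x 1 (fun x => f (a * x + b)) (a * derive1 f (a * x + b)).
  have hf : is_derive (a * x + b) 1 f (derive1 f (a * x + b)).
    by rewrite derive1E; exact/derivableP/df.
  have := @is_derive1_comp R f (fun x => a * x + b) x _ _ hf (aff x).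
  by rewrite mulrC.
split=> [x|]; first by have [] := H x.
rewrite (_ : derive1 _ = fun x => a * derive1 f (a * x + b)).
  by apply: deriv_nM; [exact: deriv_n_cst|exact: ih].
by apply/funext => x; rewrite derive1E; have [] := H x.
Qed.

Lemma CinftyM f g : Cinfty f -> Cinfty g -> Cinfty (fun x => f x * g x).
Proof. by move=> Cf Cg n; exact: deriv_nM. Qed.

Lemma Cinfty_affine f a b : Cinfty f -> Cinfty (fun x => f (a * x + b)).
Proof. by move=> Cf n; exact: deriv_n_affine. Qed.

(* The derivatives of [flat 0] are linear combinations of the [flat k]. *)
Definition flat (k : nat) (x : R) := if 0 < x then expR (- x^-1) / x ^+ k else 0.

(** [expR x^-1] dominates the term of degree [k.+1] of its Taylor series, which beats the pole
    [x ^- k] by one power of [x]. The linear bound serves differentiability at the origin. *)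
Lemma flat_le k x : 0 < x -> flat k x <= (k.+1)`!%:R * x.
Proof.
move=> x0; rewrite /flat x0 expRN ler_pdivrMr ?exprn_gt0//.
rewrite -mulrA -exprS -[leLHS]mul1r ler_pdivrMr ?expR_gt0// mulrC.
have := @expR_ge1Dxn R x^-1 k (ltac:(by rewrite invr_ge0 ltW)).
rewrite exprVn => h.
rewrite -ler_pdivrMr ?mulr_gt0 ?exprn_gt0 ?ltr0n ?fact_gt0// div1r invfM.
rewrite mulrC; lra.
Qed.

Lemma flat_ge0 k x : 0 <= flat k x.
Proof.
by rewrite /flat; case: ifP => // x0; rewrite divr_ge0 ?expR_ge0 ?exprn_ge0 ?ltW.
Qed.

Lemma flat_is_derive k (x : R) :
  is_derive x 1 (flat k) (flat k.+2 x - k%:R * flat k.+1 x).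
Proof.
have [x0|x0|->] := ltgtP x 0.
- apply: (@near_eq_is_derive _ _ _ (fun=> 0)).
    near=> y; rewrite /flat ifF//; apply/negbTE; rewrite -leNgt ltW//.
    near: y; exact: lt_nbhsl.
  by rewrite /flat ltNge (ltW x0)/= mulr0 subr0; exact: is_derive_cst.
- apply: (@near_eq_is_derive R R R (fun y : R => expR (- y^-1) * (y ^+ k)^-1)).
    near=> y; rewrite /flat ifT//; near: y; exact: lt_nbhsr.
  have xn0 : x != 0 by rewrite gt_eqF.
  have dV : is_derive x 1 (fun y : R => y^-1) (- x ^- 2).
    by apply: is_derive_eq; [exact: is_deriveV|rewrite scaler1].
  have dX : is_derive x 1 (fun y : R => (y ^+ k)^-1)
      (- (x ^+ k) ^- 2 *: (k%:R * x ^+ k.-1)).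
    apply: is_deriveV; [by rewrite expf_neq0|].
    apply: DeriveDef; [exact: exprn_derivable|by rewrite exp_derive /GRing.scale/= mulr1].
  have dE : is_derive x 1 (fun y : R => expR (- y^-1)) (expR (- x^-1) * x ^- 2).
    have h := @is_deriveN _ _ _ _ _ _ _ dV; rewrite opprK in h.
    exact: (@is_derive1_comp R expR (fun y => - y^-1) x _ _ _ h).
  apply: is_derive_eq.
  rewrite /flat x0 /=; case: k {dX} => [|k].
    by rewrite /= !mul0r scaler0 expr0 invr1; rewrite /GRing.scale/=; field.
  by rewrite /= /GRing.scale/= !exprS; field; rewrite ?xn0 ?expf_neq0.
- rewrite /flat ltxx mulr0 subr0.
  have lim0 : (fun h : R => h^-1 *: (flat k (h *: 1 + 0) - flat k 0)) h
      @[h --> 0^'] --> (0 : R).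
    (* For [h > 0] the difference quotient at the origin is [flat k.+1 h], and [C] is the constant
       that [flat_le] gives for it. *)
    pose C : R := (k.+2)`!%:R.
    apply: (@squeeze_cvgr _ _ _ _ (fun=> 0) (fun h => C * `|h|)).
    + near=> h; have hn0 : h != 0 by near: h; exact: nbhs_dnbhs_neq.
      rewrite addr0 /GRing.scale/= mulr1 {2 4}/flat ltxx subr0.
      have [h0|h0] := ltP 0 h; last first.
        by rewrite /flat ltNge h0/= mulr0 lexx/= mulr_ge0.
      have -> : h^-1 * flat k h = flat k.+1 h.
        by rewrite /flat h0 exprS invfM; ring.
      by rewrite flat_ge0 gtr0_norm//= flat_le.
    + exact: cvg_cst.
    + rewrite -[X in _ --> X](mulr0 C) -[X in C * X](@normr0 R R).
      apply: cvgM; first exact: cvg_cst.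
      apply: cvg_norm; apply: cvg_within_filter; exact: cvg_id.
  apply: DeriveDef; first by apply/cvg_ex; exists 0.
  exact/cvg_lim.
Unshelve. all: by end_near. Qed.

Lemma Cinfty_flat k : Cinfty (flat k).
Proof.
move=> n; elim: n k => // n ih k; split=> [x|].
  by have [] := flat_is_derive k x.
rewrite (_ : derive1 _ = fun x => flat k.+2 x + - k%:R * flat k.+1 x).
  by apply: deriv_nD; [|apply: deriv_nM; [exact: deriv_n_cst|]]; exact: ih.
apply/funext => x; rewrite derive1E.
by have [_ ->] := flat_is_derive k x; rewrite mulNr.
Qed.

Lemma flat0_le1 x : flat 0 x <= 1.
Proof.
rewrite /flat; case: ifP => // x0; rewrite expr0 divr1 expR_le1.
by rewrite oppr_le0 invr_ge0 ltW.
Qed.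

Lemma flat0_eq0 x : x <= 0 -> flat 0 x = 0.
Proof. by rewrite /flat ltNge => ->. Qed.

(** The inverse of the argument is a multiple of the harmonic sequence and tends to [0]. The factor
    [n.+1] keeps the argument positive from the first index on. *)
Lemma flat0_cvg (x : R) : 0 < x -> flat 0 (n.+1%:R * x) @[n --> \oo] --> (1 : R).
Proof.
move=> x0; rewrite -[X in _ --> X]expR0 /flat.
under eq_fun do rewrite mulr_gt0// expr0 divr1 invfM.
apply: continuous_cvg; first exact: continuous_expR.
rewrite -[X in _ --> X]oppr0; apply: cvgN.
rewrite -[X in _ --> X](mul0r x^-1); apply: cvgM; last exact: cvg_cst.
exact: cvg_harmonic.
Qed.

End smooth_real_functions.

(** * Tensor products of one-variable functions and bumps of boxes *)

Section product_test_functions.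
Context {R : realType} {d : nat}.
Implicit Types (g : 'I_d -> R -> R) (l u : 'I_d -> R).

Definition tensor g (x : 'rV[R]_d) : R := \prod_i g i (x 0 i).

Lemma continuous_tensor g : (forall i, continuous (g i)) ->
  continuous (tensor g).
Proof.
move=> cg; apply: (@continuous_prod R 'rV[R]_d) => i x.
apply: (@continuous_comp _ _ _ (fun y : 'rV[R]_d => y 0 i)).
  exact: coord_continuous.
exact: cg.
Qed.

(** The difference quotient in direction [j] is that of [g j] times the product [C] of the other
    factors, which stay constant along this direction. *)
Lemma tensor_is_derive g (x : 'rV[R]_d) (j : 'I_d) : derivable (g j) (x 0 j) 1 ->
  is_derive x (delta_mx 0 j) (tensor g)
    (tensor (fun i => if i == j then derive1 (g j) else g i) x).
Proof.
move=> dg; pose C := \prod_(i | i != j) g i (x 0 i).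
have E (h : R) : h^-1 *: (tensor g (h *: delta_mx 0 j + x) - tensor g x) =
    C * (h^-1 *: (g j (h *: 1 + x 0 j) - g j (x 0 j))).
  rewrite /tensor (bigD1 j)//= [in X in _ - X](bigD1 j)//= !mxE !eqxx mulr1.
  rewrite (eq_bigr (fun i => g i (x 0 i))); last first.
    by move=> i ij; rewrite !mxE (negbTE ij) mulr0 add0r.
  by rewrite /GRing.scale/= mulr1 /C; ring.
have cv : (fun h : R => h^-1 *: (tensor g (h *: delta_mx 0 j + x) - tensor g x)) h
    @[h --> 0^'] --> C * derive1 (g j) (x 0 j).
  under eq_fun do rewrite E.
  apply: cvgM; first exact: cvg_cst.
  by rewrite derive1E; exact: dg.
have -> : tensor (fun i => if i == j then derive1 (g j) else g i) x =
    C * derive1 (g j) (x 0 j).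
  rewrite /tensor (bigD1 j)//= eqxx mulrC; congr (_ * _).
  by apply: eq_bigr => i /negbTE ->.
apply: DeriveDef; first by apply/cvg_ex; exists (C * derive1 (g j) (x 0 j)).
exact/cvg_lim.
Qed.

(** A partial derivative keeps the tensor form, with one factor differentiated, so every iterated
    derivative is again a product of smooth one-variable functions. *)
Lemma smooth_tensor g : (forall i, Cinfty (g i)) -> smooth (tensor g).
Proof.
move=> Cg s.
have [g' [-> Cg']] : exists g', foldr partial (tensor g) s = tensor g' /\
    forall i, Cinfty (g' i).
  elim: s => [|j s [g' [/= -> Cg']]]; first by exists g.
  exists (fun i => if i == j then derive1 (g' j) else g' i); split.
    apply/funext => x; have dg := @Cinfty_derivable R _ (x 0 j) (Cg' j).
    by rewrite /partial; have [_ ->] := tensor_is_derive dg.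
  by move=> i; case: ifP => // _; exact: Cinfty_derive1.
split; first by apply: continuous_tensor => i; exact: Cinfty_continuous.
move=> x j; have dg := @Cinfty_derivable R _ (x 0 j) (Cg' j).
by have [] := tensor_is_derive dg.
Qed.

Definition box_bump l u (n : nat) : 'rV[R]_d -> R := tensor (fun i x =>
  flat 0 (n.+1%:R * (x - l i)) * flat 0 (n.+1%:R * (u i - x))).

Lemma smooth_box_bump l u n : smooth (box_bump l u n).
Proof.
apply: smooth_tensor => i; apply: CinftyM.
  have := Cinfty_affine n.+1%:R (- (n.+1%:R * l i)) (@Cinfty_flat R 0).
  by congr Cinfty; apply/funext => x; rewrite mulrBr.
have := Cinfty_affine (- n.+1%:R) (n.+1%:R * u i) (@Cinfty_flat R 0).
by congr Cinfty; apply/funext => x; rewrite mulrBr addrC mulNr.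
Qed.

Lemma box_bump_eq0 l u n x : ~ openbox l u x -> box_bump l u n x = 0.
Proof.
move=> /existsNP[i /negP]; rewrite negb_and -!leNgt => h.
rewrite /box_bump /tensor (bigD1 i)//=.
have n0 : 0 <= n.+1%:R :> R by [].
case/orP: h => h; rewrite -subr_le0 in h.
  by rewrite (flat0_eq0 (mulr_ge0_le0 n0 h)) !mul0r.
by rewrite (flat0_eq0 (mulr_ge0_le0 n0 h)) mulr0 mul0r.
Qed.

Lemma box_bump_ge0 l u n x : 0 <= box_bump l u n x.
Proof. by apply: prodr_ge0 => i _; rewrite mulr_ge0// flat_ge0. Qed.

Lemma box_bump_le1 l u n x : box_bump l u n x <= 1.
Proof.
rewrite /box_bump /tensor -[leRHS](@big1_eq R 1 *%R 'I_d (index_enum 'I_d) xpredT).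
apply: ler_prod => i _; rewrite mulr_ge0 ?flat_ge0//=.
by rewrite mulr_ile1 ?flat_ge0 ?flat0_le1.
Qed.

Lemma box_bump_cvg l u x : openbox l u x ->
  box_bump l u n x @[n --> \oo] --> (1 : R).
Proof.
move=> lux; have := @cvg_bigprod R 'I_d (index_enum 'I_d) (fun i n =>
  flat 0 (n.+1%:R * (x 0 i - l i)) * flat 0 (n.+1%:R * (u i - x 0 i))) (fun=> 1).
rewrite big1_eq; apply => i.
rewrite -[X in _ --> X]mul1r; have /andP[li ui] := lux i.
by apply: cvgM; apply: flat0_cvg; rewrite subr_gt0.
Qed.

Lemma closed_closedbox l u : closed (closedbox l u).
Proof.
rewrite (_ : closedbox l u = \bigcap_i ((fun x : 'rV[R]_d => x 0 i) @^-1`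
    `[l i, u i]%classic)).
  apply: closed_bigI => i _; apply: preimage_closed; last exact: interval_closed.
  by move=> x _; exact: coord_continuous.
apply/seteqP; split => x /= h i; have := h i; rewrite /= ?in_itv//= => h' //.
exact: h'.
Qed.

Lemma compact_closedbox l u : compact (closedbox l u).
Proof.
apply: bounded_closed_compact; last exact: closed_closedbox.
exists (\sum_i (`|l i| + `|u i|)); split; first exact: num_real.
move=> M hM x /= xlu; rewrite [leLHS]/Num.norm/= mx_normrE.
have M0 : 0 <= M by apply: le_trans (ltW hM); apply: sumr_ge0 => i _; rewrite addr_ge0.
apply/bigmax_leP; split => // -[i j] _ /=; rewrite ord1.
apply: le_trans (ltW hM).
apply: (@le_trans _ _ (`|l j| + `|u j|)).
  have /andP[h1 h2] := xlu j; rewrite ler_norml.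
  have := ler_norm (u j); have := ler_norm (- l j); rewrite normrN.
  by have := normr_ge0 (u j); have := normr_ge0 (l j); lra.
by rewrite (bigD1 j)//= lerDl sumr_ge0// => ? _; rewrite addr_ge0.
Qed.

(** A bump vanishes off the open box, so its support lies in the closed box, which is compact and
    contained in [D]. *)
Lemma test_function_box_bump (D : set 'rV[R]_d) l u n :
  closedbox l u `<=` D -> test_function D (box_bump l u n).
Proof.
move=> luD.
have sub : closure [set x | box_bump l u n x != 0] `<=` closedbox l u.
  rewrite [X in _ `<=` X](closure_id _).1; last exact: closed_closedbox.
  apply: closureS => x /= /eqP; apply: contra_notP => h.
  apply: box_bump_eq0; apply: contra_not h => h i.
  by have /andP[/ltW -> /ltW ->] := h i.
split; first exact: smooth_box_bump.
  exact: (subclosed_compact (@closed_closure _ _) (@compact_closedbox l u) sub).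
exact: subset_trans sub luD.
Qed.

End product_test_functions.

(** * Uniqueness of weak gradients *)

Section du_bois_reymond.
Context {R : realType} {d : nat}.
Local Notation T := (d.-tuple (measurableTypeR R)).
Local Notation mu := (@lebesgue R d).
Implicit Types (D : set 'rV[R]_d) (f : 'rV[R]_d -> R).
Local Notation pre D := (point_of @^-1` D : set T).

Definition integrable_on D f := mu.-integrable (pre D) (fun t => (f (point_of t))%:E).

Lemma integrable_on_measurable D f : integrable_on D f ->
  measurable_fun (pre D) (fun t : T => f (point_of t)).
Proof. by move=> /integrableP[mf _]; apply/measurable_EFinP. Qed.

Lemma measurable_box_bump l u n (A : set T) :
  measurable_fun A (fun t : T => box_bump l u n (point_of t)).
Proof.
apply: (@measurable_funS _ _ _ _ setT) => //.
apply: measurable_continuous => x.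
by have [/= c _] := @smooth_box_bump R d l u n [::]; exact: c.
Qed.

Lemma integrable_onM D f (g : 'rV[R]_d -> R) (M : R) : measurable (pre D) ->
  integrable_on D f -> measurable_fun (pre D) (fun t : T => g (point_of t)) ->
  (forall x, D x -> `|g x| <= M) -> integrable_on D (fun x => f x * g x).
Proof.
move=> mD fi mg gM.
apply: (@le_integrable _ _ _ _ _ mD _ (fun t => (M * f (point_of t))%:E)).
- apply/measurable_EFinP; apply: measurable_funM => //.
  exact: integrable_on_measurable.
- move=> t Dt; rewrite /= lee_fin !normrM mulrC ler_wpM2r//.
  by apply: le_trans (gM _ Dt) _; exact: ler_norm.
- exact: (integrableZl mD M fi).
Qed.

(** The bumps of the box are test functions with values between [0] and [1] that converge to its
    indicator, so dominated convergence with majorant [|f|] passes to the limit. *)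
Lemma box_integral_eq0 D f l u : open D -> integrable_on D f ->
  (forall phi, test_function D phi -> integral_on D (fun x => f x * phi x) = 0) ->
  closedbox l u `<=` D ->
  (\int[mu]_(t in pre (openbox l u)) (f (point_of t))%:E = 0)%E.
Proof.
move=> oD fi f0 luD.
have mD := measurable_open_preimage oD.
have mB : measurable (pre (openbox l u)) := measurable_openbox l u.
have mf : measurable_fun (pre D) (fun t : T => f (point_of t)).
  exact: integrable_on_measurable.
have bumpi n : integrable_on D (fun x => f x * box_bump l u n x).
  apply: (@integrable_onM _ _ _ 1) => //; first exact: measurable_box_bump.
  by move=> x _; rewrite ger0_norm ?box_bump_ge0 ?box_bump_le1.
pose h (t : T) := (f (point_of t) * \1_(pre (openbox l u)) t)%:E.
pose h_ n (t : T) := (f (point_of t) * box_bump l u n (point_of t))%:E.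
have [_ _ cv] : [/\ mu.-integrable (pre D) h,
    [sequence (\int[mu]_(x in pre D) `|h_ n x - h x|)%E]_n @ \oo --> (0 : \bar R) &
    [sequence (\int[mu]_(x in pre D) h_ n x)%E]_n @ \oo -->
      (\int[mu]_(x in pre D) h x)%E].
  apply: (@dominated_convergence _ _ _ _ _ mD _ _
      (fun t => `|(f (point_of t))%:E|%E)).
  - by move=> n; exact: (measurable_int _ (bumpi n)).
  - by apply/measurable_EFinP; apply: measurable_funM => //; exact: measurable_indic.
  - apply: aeW => t Dt; apply: cvg_EFin; first by near=> n.
    rewrite /h_ /h /=; apply: cvgM; first exact: cvg_cst.
    rewrite indicE; have [tB|tB] := pselect (openbox l u (point_of t)).
      by rewrite mem_set//; exact: box_bump_cvg.
    rewrite memNset//; under eq_fun do rewrite box_bump_eq0//.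
    exact: cvg_cst.
  - by have := integrable_abse fi.
  - apply: aeW => t n Dt; rewrite /h_ /= lee_fin normrM ler_piMr//.
    by rewrite ger0_norm ?box_bump_ge0 ?box_bump_le1.
have h_0 n : (\int[mu]_(x in pre D) h_ n x = 0)%E.
  have := f0 _ (test_function_box_bump n luD); rewrite /integral_on /Rintegral => e.
  (* [integral_on] applies [fine], which sends infinite values to [0] as well; integrability rules
     these out. *)
  by rewrite -[LHS]fineK ?e//; exact: integrable_fin_num (bumpi n).
have h0 : (\int[mu]_(x in pre D) h x = 0)%E.
  rewrite (_ : [sequence _]_n = fun=> 0%E) in cv; last first.
    by apply/funext => n; exact: h_0.
  exact: (cvg_unique (@ereal_hausdorff R) cv (cvg_cst _)).
have BD : pre (openbox l u) `<=` pre D.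
  by move=> t tB; apply: luD => i; have /andP[/ltW -> /ltW ->] := tB i.
rewrite -(setIidr BD) integral_mkcondr -[RHS]h0.
apply: eq_integral => t _; rewrite patchE /h indicE.
by case: ifPn => _; rewrite ?mulr1 ?mulr0.
Unshelve. all: by end_near. Qed.

(** The measurable sets [A] for which the integral of [f] over the intersection of [A] with the box
    [B] vanishes form a Dynkin class. It contains the orthants, since an orthant cuts a box in a
    box. Hence it contains all measurable sets, and [f] vanishes almost everywhere on [B]. *)
Lemma openbox_ae_eq0 D f l u : open D -> integrable_on D f ->
  (forall phi, test_function D phi -> integral_on D (fun x => f x * phi x) = 0) ->
  closedbox l u `<=` D ->
  {ae mu, forall t : T, pre (openbox l u) t -> f (point_of t) = 0}.
Proof.
move=> oD fi f0 luD.
have mD := measurable_open_preimage oD.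
set B := pre (openbox l u).
have mB : measurable B := measurable_openbox l u.
have BD : B `<=` pre D.
  by move=> t tB; apply: luD => i; have /andP[/ltW -> /ltW ->] := tB i.
have fiB : mu.-integrable B (fun t : T => (f (point_of t))%:E).
  exact: integrableS BD fi.
have fiS A : measurable A -> A `<=` B ->
    mu.-integrable A (fun t : T => (f (point_of t))%:E).
  by move=> mA AB; exact: integrableS AB fiB.
have B0 : (\int[mu]_(t in B) (f (point_of t))%:E = 0)%E.
  exact: (box_integral_eq0 oD fi f0 luD).
have H A : measurable A -> (\int[mu]_(t in A `&` B) (f (point_of t))%:E = 0)%E.
  move=> mA; have := mA; rewrite measurable_upper_orthantE.
  move: A {mA}; apply: (@dynkin_induction _ T (range upper_orthant)
    (fun A => \int[mu]_(t in A `&` B) (f (point_of t))%:E = 0)%E).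
  - exact: measurable_upper_orthantE.
  - exact: setI_closed_upper_orthant.
  - by rewrite setTI.
  - move=> _ [a _ <-].
    rewrite (_ : _ `&` _ = pre (openbox (fun i => Num.max (a i) (l i)) u)).
      apply: (box_integral_eq0 oD fi f0) => x xb; apply: luD => i.
      by have := xb i; rewrite ge_max => /andP[/andP[_ ->] ->].
    apply/seteqP; split => t; rewrite /B /upper_orthant /openbox /=.
      by move=> [h1 h2] i; have := h2 i; rewrite gt_max !mxE h1.
    move=> h; split=> i; have := h i; rewrite gt_max !mxE => /andP[/andP[]] //.
    by move=> _ -> ->.
  - move=> S mS S0.
    have mSC : measurable (~` S) by exact: measurableC.
    have SB : (S `&` B) `|` (~` S `&` B) = B by rewrite -setIUl setUv setTI.
    (* Closure under complements rests on the integral over [B] itself being zero. *)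
    have := B0; rewrite -{1}SB integral_setU.
    + by rewrite S0 add0e.
    + exact: measurableI.
    + exact: measurableI.
    + by rewrite SB; exact: measurable_int fiB.
    + apply/disj_setPS => t [[St _] [nSt _]]; exact: nSt.
  - move=> F mF tF F0; rewrite setI_bigcupl integral_bigcup.
    + by rewrite eseries0.
    + apply/trivIsetP => i j _ _ ij; rewrite setIACA.
      by move/trivIsetP : tF => ->//; rewrite set0I.
    + by move=> i; exact: measurableI.
    + rewrite -setI_bigcupl; apply: fiS; last by move=> t [].
      by apply: measurableI => //; exact: bigcupT_measurable.
have := @integral_ae_eq _ _ _ mu B mB (cst 0%E) _ fiB.
move=> /(_ (measurable_cst _)) h.
have {}h : ae_eq mu B (fun t : T => (f (point_of t))%:E) (cst 0%E).
  apply: h => E EB mE; rewrite integral0.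
  by rewrite -{1}(setIidl EB); exact: H.
by apply: filterS h => t /= + Bt => /(_ Bt) [].
Qed.

(** This is the fundamental lemma of the calculus of variations. [D] is a union of countably many
    rational boxes whose closed versions lie in [D], and [ae_foralln] merges their exceptional null
    sets through the codes [n]. *)
Lemma du_bois_reymond D f : open D -> integrable_on D f ->
  (forall phi, test_function D phi -> integral_on D (fun x => f x * phi x) = 0) ->
  {ae mu, forall t : T, pre D t -> f (point_of t) = 0}.
Proof.
move=> oD fi f0.
have /ae_foralln H : forall n, {ae mu, forall t : T,
    forall p : {ffun 'I_d -> rat * rat}, unpickle n = Some p ->
    closedbox (fun i => ratr (p i).1) (fun i => ratr (p i).2) `<=` D ->
    ratbox p (point_of t) -> f (point_of t) = 0}.
  move=> n; case: (unpickle n : option {ffun 'I_d -> rat * rat}) => [p|]; last first.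
    by apply: aeW.
  have [pD|npD] := pselect (closedbox (fun i => ratr (p i).1)
      (fun i => ratr (p i).2) `<=` D).
    apply: filterS (openbox_ae_eq0 oD fi f0 pD) => t h _ [<-] _; exact: h.
  by apply: aeW => t _ [<-].
apply: filterS H => t /= h Dt.
have [p [px pD]] := open_ratbox oD Dt.
exact: (h (pickle p) p (pickleK p) pD px).
Qed.

End du_bois_reymond.

(** * Square integrable fields and linearity of weak gradients under the integral *)

Section square_integrable_functions.
Context {R : realType} {d : nat}.
Local Notation T := (d.-tuple (measurableTypeR R)).
Local Notation mu := (@lebesgue R d).
Variable D : set 'rV[R]_d.
Hypotheses (oD : open D) (bD : bounded_set D).
Local Notation pre D := (point_of @^-1` D : set T).
Implicit Types f g : 'rV[R]_d -> R.

Let mD : measurable (pre D). Proof. exact: measurable_open_preimage. Qed.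

Lemma eq_integral_on f g : (forall x, D x -> f x = g x) ->
  integral_on D f = integral_on D g.
Proof. by move=> fg; apply: eq_Rintegral => t /set_mem/fg. Qed.

Lemma integral_onD f g : integrable_on D f -> integrable_on D g ->
  integral_on D (fun x => f x + g x) = integral_on D f + integral_on D g.
Proof. by move=> fi gi; exact: RintegralD. Qed.

Lemma integral_onZ a f : integrable_on D f ->
  integral_on D (fun x => a * f x) = a * integral_on D f.
Proof. by move=> fi; exact: RintegralZl. Qed.

Lemma integrable_onD f g : integrable_on D f -> integrable_on D g ->
  integrable_on D (fun x => f x + g x).
Proof. by move=> fi gi; exact: (integrableD mD fi gi). Qed.

Lemma integrable_onZ a f : integrable_on D f -> integrable_on D (fun x => a * f x).
Proof. by move=> fi; exact: (integrableZl mD a fi). Qed.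

Lemma integrable_on_sum (I : Type) (s : seq I) (h : I -> 'rV[R]_d -> R) :
  (forall i, integrable_on D (h i)) ->
  integrable_on D (fun x => \sum_(i <- s) h i x).
Proof.
move=> hi; elim: s => [|i s ih].
  rewrite /integrable_on; under eq_fun do rewrite big_nil; exact: integrable0.
rewrite /integrable_on; under eq_fun do rewrite big_cons.
exact: (@integrable_onD (h i) (fun x => \sum_(j <- s) h j x)).
Qed.

Lemma square_integrableM f g : square_integrable D f -> square_integrable D g ->
  integrable_on D (fun x => f x * g x).
Proof.
move=> [mf fi] [mg gi].
apply: (@le_integrable _ _ _ _ _ mD _ (fun t =>
  (f (point_of t) ^+ 2 + g (point_of t) ^+ 2)%:E)).
- by apply/measurable_EFinP; exact: measurable_funM.
- move=> t _; rewrite /= lee_fin [leRHS]ger0_norm ?addr_ge0 ?sqr_ge0//.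
  rewrite normrM -(real_normK (num_real (f _))) -(real_normK (num_real (g _))).
  set x := `|f _|; set y := `|g _|.
  have : 0 <= (x - y) ^+ 2 by exact: sqr_ge0.
  have : 0 <= x * y by rewrite /x /y mulr_ge0.
  by rewrite sqrrB; lra.
- exact: (integrableD mD fi gi).
Qed.

Lemma square_integrableD f g : square_integrable D f -> square_integrable D g ->
  square_integrable D (fun x => f x + g x).
Proof.
move=> hf hg; have fg := square_integrableM hf hg.
case: hf hg => [mf fi] [mg gi]; split; first exact: measurable_funD.
apply: (@eq_integrable _ _ _ _ _ mD (fun t => (f (point_of t) ^+ 2)%:E +
    ((g (point_of t) ^+ 2)%:E + 2%:E * (f (point_of t) * g (point_of t))%:E))%E).
  by move=> t _; rewrite -EFinM -!EFinD sqrrD; congr EFin; ring.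
apply: integrableD => //; apply: integrableD => //; exact: (integrableZl mD 2 fg).
Qed.

Lemma square_integrableZ a f : square_integrable D f ->
  square_integrable D (fun x => a * f x).
Proof.
move=> [mf fi]; split.
  by apply: measurable_funM => //; exact: measurable_cst.
apply: (@eq_integrable _ _ _ _ _ mD (fun t =>
    ((a ^+ 2)%:E * (f (point_of t) ^+ 2)%:E)%E)).
  by move=> t _; rewrite -EFinM exprMn.
exact: integrableZl.
Qed.

(** Products of square integrable functions need not be square integrable. The cubic terms are
    therefore handled in this class, which is closed under products and whose members are square
    integrable because [D] is bounded. *)
Definition bounded_measurable f := measurable_fun (pre D) (f \o (@point_of R d)) /\
  exists M, forall x, D x -> `|f x| <= M.

Lemma bounded_measurable_cst a : bounded_measurable (fun=> a).
Proof. by split; [exact: measurable_cst|exists `|a|]. Qed.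

Lemma bounded_measurableD f g : bounded_measurable f -> bounded_measurable g ->
  bounded_measurable (fun x => f x + g x).
Proof.
move=> [mf [M fM]] [mg [M' gM]]; split; first exact: measurable_funD.
exists (M + M') => x Dx; apply: le_trans (ler_normD _ _) _.
by rewrite lerD ?fM ?gM.
Qed.

Lemma bounded_measurableM f g : bounded_measurable f -> bounded_measurable g ->
  bounded_measurable (fun x => f x * g x).
Proof.
move=> [mf [M fM]] [mg [M' gM]]; split; first exact: measurable_funM.
by exists (M * M') => x Dx; rewrite normrM ler_pM ?fM ?gM.
Qed.

Lemma bounded_measurableZ a f : bounded_measurable f ->
  bounded_measurable (fun x => a * f x).
Proof. by move=> h; apply: bounded_measurableM => //; exact: bounded_measurable_cst. Qed.

Lemma bounded_measurable_sum (I : Type) (s : seq I) (h : I -> 'rV[R]_d -> R) :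
  (forall i, bounded_measurable (h i)) ->
  bounded_measurable (fun x => \sum_(i <- s) h i x).
Proof.
move=> hi; elim: s => [|i s ih].
  by under eq_fun do rewrite big_nil; exact: bounded_measurable_cst.
by under eq_fun do rewrite big_cons; exact: bounded_measurableD.
Qed.

Lemma bounded_measurable_integrable f : bounded_measurable f -> integrable_on D f.
Proof.
move=> [mf [M fM]].
apply: (@le_integrable _ _ _ _ _ mD _ (cst M%:E)); first exact/measurable_EFinP.
  move=> t Dt; rewrite /= lee_fin; apply: le_trans (fM _ Dt) (ler_norm _).
apply/integrableP; split; first exact: measurable_cst.
rewrite (eq_integral (cst `|M|%:E))// integral_cst// lte_mul_pinfty//.
exact: bounded_lebesgue_fin.
Qed.

Lemma bounded_measurable_square f : bounded_measurable f -> square_integrable D f.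
Proof.
move=> hf; split; first by case: hf.
exact: (bounded_measurable_integrable (bounded_measurableM hf hf)).
Qed.

Lemma compact_closure_bounded : compact (closure D).
Proof.
case: bD => M [_ hM]; pose M' := `|M| + 1.
have DM : D `<=` closedbox (fun=> - M') (fun=> M').
  move=> x Dx i; rewrite -ler_norml.
  apply: le_trans (hM M' _ _ Dx); last by rewrite /M'; have := ler_norm M; lra.
  rewrite [leRHS]/Num.norm/= mx_normrE.
  by apply/bigmax_geP; right => /=; exists (0, i).
apply: (subclosed_compact (@closed_closure _ _)
  (@compact_closedbox R d (fun=> - M') (fun=> M'))).
rewrite [X in _ `<=` X](closure_id _).1; last exact: closed_closedbox.
exact: closureS.
Qed.

Lemma within_continuous_bounded f : {within closure D, continuous f} ->
  exists M, forall x, D x -> `|f x| <= M.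
Proof.
move=> cf; have [M [_ hM]] :=
  compact_bounded (continuous_compact cf compact_closure_bounded).
exists (`|M| + 1) => x Dx; apply: (hM (`|M| + 1)).
  by have := ler_norm M; lra.
by exists x => //; exact: subset_closure.
Qed.

Lemma continuous_bounded_measurable f : continuous f -> bounded_measurable f.
Proof.
move=> cf; split; last exact/within_continuous_bounded/continuous_subspaceT.
by apply: (@measurable_funS _ _ _ _ setT) => //; exact: measurable_continuous.
Qed.

Lemma test_function_bounded_measurable phi : test_function D phi ->
  bounded_measurable phi.
Proof. by move=> [/(_ [::])[c _] _ _]; exact: continuous_bounded_measurable. Qed.

Lemma partial_bounded_measurable phi j : test_function D phi ->
  bounded_measurable (partial j phi).
Proof. by move=> [/(_ [:: j])[c _] _ _]; exact: continuous_bounded_measurable. Qed.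

Definition L2 m n (G : 'rV[R]_d -> 'M[R]_(m, n)) :=
  forall i j, square_integrable D (fun x => G x i j).

Lemma L2D m n (F G : 'rV[R]_d -> 'M[R]_(m, n)) a : L2 F -> L2 G ->
  L2 (fun x => a *: F x + G x).
Proof.
move=> hF hG i j; under eq_fun do rewrite !mxE.
by apply: square_integrableD => //; exact: square_integrableZ.
Qed.

Lemma L2_integrable m n (F G : 'rV[R]_d -> 'M[R]_(m, n)) : L2 F -> L2 G ->
  integrable_on D (fun x => mxdot (F x) (G x)).
Proof.
move=> hF hG; apply: integrable_on_sum => i; apply: integrable_on_sum => j.
exact: square_integrableM.
Qed.

Lemma L2innerC m n (F G : 'rV[R]_d -> 'M[R]_(m, n)) :
  L2inner D F G = L2inner D G F.
Proof. by apply: eq_integral_on => x _; exact: mxdotC. Qed.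

Lemma L2inner_linl m n (F G H : 'rV[R]_d -> 'M[R]_(m, n)) a :
  L2 F -> L2 G -> L2 H ->
  L2inner D (fun x => a *: F x + G x) H = a * L2inner D F H + L2inner D G H.
Proof.
move=> hF hG hH; have iFH := L2_integrable hF hH; have iGH := L2_integrable hG hH.
rewrite /L2inner -integral_onZ// -integral_onD//; last exact: integrable_onZ.
by apply: eq_integral_on => x _; rewrite mxdotDl mxdotZl.
Qed.

Lemma L2inner_linr m n (F G H : 'rV[R]_d -> 'M[R]_(m, n)) a :
  L2 F -> L2 G -> L2 H ->
  L2inner D H (fun x => a *: F x + G x) = a * L2inner D H F + L2inner D H G.
Proof. by move=> hF hG hH; rewrite L2innerC L2inner_linl// !(L2innerC H). Qed.

Lemma L2inner_ge0 m n (F : 'rV[R]_d -> 'M[R]_(m, n)) : 0 <= L2inner D F F.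
Proof. by apply: Rintegral_ge0 => t _; exact: mxdot_ge0. Qed.

Lemma eq_L2inner m n (F F' G G' : 'rV[R]_d -> 'M[R]_(m, n)) :
  (forall x, D x -> F x = F' x) -> (forall x, D x -> G x = G' x) ->
  L2inner D F G = L2inner D F' G'.
Proof. by move=> FF GG; apply: eq_integral_on => x Dx; rewrite FF ?GG. Qed.

Lemma weak_gradient_L2 v G : is_weak_gradient D v G -> L2 G.
Proof. by move=> h i j; have [] := h i j. Qed.

(** Both gradients pair equally with test functions, so each entry of their difference vanishes
    almost everywhere. The conclusion compares inner products because gradients are determined only
    up to null sets. *)
Lemma weak_gradient_unique v G G' K : is_weak_gradient D v G ->
  is_weak_gradient D v G' -> L2 K -> L2inner D G K = L2inner D G' K.
Proof.
move=> hG hG' hK.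
have LG := weak_gradient_L2 hG; have LG' := weak_gradient_L2 hG'.
pose f i j x := G x i j + (-1) * G' x i j.
have sf i j : square_integrable D (f i j).
  by apply: square_integrableD => //; exact: square_integrableZ.
have f0 i j : {ae mu, forall t : T, pre D t -> f i j (point_of t) = 0}.
  apply: (du_bois_reymond oD).
    (* The constant [1] is square integrable on the bounded set [D], so a square integrable function
       is integrable as its product with [1]. *)
    have := square_integrableM (sf i j)
      (bounded_measurable_square (bounded_measurable_cst 1)).
    by rewrite /integrable_on; under eq_fun do rewrite mulr1.
  move=> phi tphi.
  have sphi := bounded_measurable_square (test_function_bounded_measurable tphi).
  have [_ /(_ phi tphi) e] := hG i j; have [_ /(_ phi tphi)] := hG' i j.
  rewrite e => /oppr_inj e'.
  have i1 := square_integrableM (LG i j) sphi.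
  have i2 := square_integrableM (LG' i j) sphi.
  transitivity (integral_on D (fun x => G x i j * phi x + (-1) * (G' x i j * phi x))).
    by apply: eq_integral_on => x _; rewrite /f mulrDl mulrA.
  by rewrite integral_onD ?integral_onZ//; [rewrite e'; lra|exact: integrable_onZ].
have f0K i j : integral_on D (fun x => f i j x * K x i j) = 0.
  rewrite /integral_on /Rintegral.
  rewrite (ae_eq_integral (cst 0%E)) ?integral0//.
  - by apply/measurable_EFinP; apply: measurable_funM; [case: (sf i j)|case: (hK i j)].
  - by apply: filterS (f0 i j) => t /= h /h ->; rewrite mul0r.
have : L2inner D (fun x => (-1) *: G' x + G x) K = 0.
  rewrite /L2inner /mxdot.
  have si i j : integrable_on D (fun x => f i j x * K x i j).
    exact: square_integrableM.
  have sum0 (I : Type) (s : seq I) (h : I -> 'rV[R]_d -> R) :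
      (forall i, integrable_on D (h i)) -> (forall i, integral_on D (h i) = 0) ->
      integral_on D (fun x => \sum_(i <- s) h i x) = 0.
    move=> hi h0; elim: s => [|i s ih].
      rewrite (@eq_integral_on _ (fun=> 0)); last by move=> x _; rewrite big_nil.
      by rewrite /integral_on /Rintegral integral0.
    rewrite (@eq_integral_on _ (fun x => h i x + \sum_(i <- s) h i x)); last first.
      by move=> x _; rewrite big_cons.
    by rewrite integral_onD ?h0 ?ih ?addr0//; exact: integrable_on_sum.
  rewrite -[RHS](@sum0 _ (index_enum 'I_3) (fun i x => \sum_j f i j x * K x i j)).
  - apply: eq_integral_on => x _; apply: eq_bigr => i _; apply: eq_bigr => j _.
    by rewrite !mxE /f addrC.
  - by move=> i; exact: integrable_on_sum.
  - by move=> i; exact: sum0.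
by rewrite L2inner_linl//; lra.
Qed.

Lemma weak_gradientD (u v : 'rV[R]_d -> 'rV[R]_3) G H a :
  (forall i, square_integrable D (fun x => u x 0 i)) ->
  (forall i, square_integrable D (fun x => v x 0 i)) ->
  is_weak_gradient D u G -> is_weak_gradient D v H ->
  is_weak_gradient D (fun x => a *: u x + v x) (fun x => a *: G x + H x).
Proof.
move=> su sv hG hH i j.
have LG := weak_gradient_L2 hG; have LH := weak_gradient_L2 hH.
split; first exact: L2D.
move=> phi tphi.
have sphi := bounded_measurable_square (test_function_bounded_measurable tphi).
have sp := bounded_measurable_square (partial_bounded_measurable j tphi).
have [_ /(_ phi tphi) e1] := hG i j; have [_ /(_ phi tphi) e2] := hH i j.
have i1 := square_integrableM (su i) sp; have i2 := square_integrableM (sv i) sp.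
have i3 := square_integrableM (LG i j) sphi.
have i4 := square_integrableM (LH i j) sphi.
transitivity (integral_on D (fun x =>
    a * (u x 0 i * partial j phi x) + v x 0 i * partial j phi x)).
  by apply: eq_integral_on => x _; rewrite !mxE mulrDl mulrA.
transitivity (- integral_on D (fun x => a * (G x i j * phi x) + H x i j * phi x)).
  rewrite !integral_onD ?integral_onZ//; [|exact: integrable_onZ|exact: integrable_onZ].
  by rewrite e1 e2; ring.
by congr (- _); apply: eq_integral_on => x _; rewrite !mxE mulrDl mulrA.
Qed.

Lemma H1_grad v : H1 D v -> is_weak_gradient D v (grad D v).
Proof. by move=> [_ h]; exact: (xgetPex (fun=> 0) h). Qed.

Lemma grad_L2 v : H1 D v -> L2 (grad D v).
Proof. by move=> /H1_grad/weak_gradient_L2. Qed.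

Lemma H1_L2 v : H1 D v -> L2 v.
Proof. by move=> [h _] i j; rewrite ord1; exact: h. Qed.

Lemma H1D u v a : H1 D u -> H1 D v -> H1 D (fun x => a *: u x + v x).
Proof.
move=> hu hv; split=> [i|]; first exact: (L2D a (H1_L2 hu) (H1_L2 hv)).
exists (fun x => a *: grad D u x + grad D v x).
by apply: weak_gradientD (H1_grad hu) (H1_grad hv); [case: hu|case: hv].
Qed.

(** The chosen gradient of the combination and the combination of the chosen gradients may differ as
    functions, but both are weak gradients of the same field. *)
Lemma L2inner_gradD u v K a : H1 D u -> H1 D v -> L2 K ->
  L2inner D (grad D (fun x => a *: u x + v x)) K =
  a * L2inner D (grad D u) K + L2inner D (grad D v) K.
Proof.
move=> hu hv hK; rewrite -L2inner_linl//; [|exact: grad_L2|exact: grad_L2].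
apply: weak_gradient_unique hK; first exact/H1_grad/H1D.
by apply: weak_gradientD (H1_grad hu) (H1_grad hv); [case: hu|case: hv].
Qed.

(** Integrals over [D] see only values on [D], so both fields have the same set of weak gradients
    and [xget] chooses the same element. This gives equality everywhere, not merely almost
    everywhere. *)
Lemma eq_grad u v : (forall x, D x -> u x = v x) -> grad D u = grad D v.
Proof.
move=> uv; congr xget; apply/seteqP.
have H w w' : (forall x, D x -> w x = w' x) ->
    is_weak_gradient D w `<=` is_weak_gradient D w'.
  move=> ww G hG i j; have [s h] := hG i j; split=> // phi /h <-.
  by apply: eq_integral_on => x Dx; rewrite ww.
by split; apply: H => // x Dx; rewrite uv.
Qed.

(** The integrand vanishes almost everywhere. By continuity a nonzero value inside [D] would persist
    on a nonempty open set, which has positive measure; boundary points follow as limits of points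
    of [D]. *)
Lemma L2inner_eq0 (v : 'rV[R]_d -> 'rV[R]_3) :
  {within closure D, continuous v} -> L2 v -> L2inner D v v = 0 ->
  forall x, closure D x -> v x = 0.
Proof.
move=> cv Lv v0.
have vi := L2_integrable Lv Lv.
have ae0 : ae_eq mu (pre D) (fun t : T => (mxdot (v (point_of t)) (v (point_of t)))%:E)
    (cst 0%E).
  apply/ae_eq_integral_abs => //; first exact: measurable_int vi.
  rewrite -[LHS]fineK; last by apply: integrable_fin_num => //; exact: integrable_abse.
  congr EFin; rewrite -[RHS]v0; congr fine; apply: eq_integral => t _ /=.
  by rewrite ger0_norm// mxdot_ge0.
have vD x : D x -> v x = 0.
  move=> Dx; apply/eqP/negPn/negP => vx.
  have cvx : {for x, continuous v}.
    have := continuous_subspaceW (@subset_closure _ D) cv.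
    by rewrite continuous_open_subspace// => /(_ x); apply; rewrite inE.
  have /nbhs_interior : \forall y \near x, D y /\ v y != 0.
    near=> y; split; near: y; first exact: open_nbhs_nbhs.
    by apply: (cvgr_neq0 _ cvx).
  set U := interior _ => Ux.
  have oU : open U by exact: open_interior.
  have := open_lebesgue_gt0 oU (ex_intro _ x (nbhs_singleton Ux)).
  apply/negP; rewrite -leNgt measure_le0; apply/eqP.
  have [A [mA A0 sA]] := ae0.
  apply/eqP; rewrite -measure_le0 -A0 le_measure ?inE//.
    exact: measurable_open_preimage.
  move=> t /interior_subset[Dt /eqP vt]; apply: sA => /= /(_ Dt) [].
  by move/mxdot_eq0.
move=> x cx; apply/eqP/negPn/negP => vx.
have cvx := (subspace_continuousP _ _).1 cv x cx.
have /nbhs_ballP[e /= e0 ve] : \forall y \near x, closure D y -> v y != 0.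
  exact: (cvgr_neq0 _ cvx).
have [y [Dy xy]] := cx _ (nbhsx_ballx x e e0).
have := ve y xy; rewrite vD// eqxx => /(_ (subset_closure Dy)).
Unshelve. all: by end_near. Qed.

End square_integrable_functions.

(** * Finite element space *)

Section linear_combinations.
Context {R : realType} {d : nat}.
Implicit Types (x y : 'rV[R]_d).

Definition comb m (v : 'I_m -> 'rV[R]_d -> 'rV[R]_3) (a : 'rV[R]_m) :
    'rV[R]_d -> 'rV[R]_3 := fun x => \sum_i a 0 i *: v i x.

Lemma combD m (v : 'I_m -> 'rV[R]_d -> 'rV[R]_3) t a b :
  comb v (t *: a + b) = fun x => t *: comb v a x + comb v b x.
Proof.
apply/funext => x; rewrite /comb scaler_sumr -big_split.
by apply: eq_bigr => i _; rewrite !mxE scalerDl scalerA.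
Qed.

Lemma comb_delta m (v : 'I_m -> 'rV[R]_d -> 'rV[R]_3) i :
  comb v (delta_mx 0 i) = v i.
Proof.
apply/funext => x; rewrite /comb (bigD1 i)//= mxE !eqxx scale1r.
rewrite big1 ?addr0// => j ji; rewrite mxE eqxx/= (negbTE ji) scale0r//.
Qed.

Lemma crosspDr (u v w : 'rV[R]_3) a :
  crossp u (a *: v + w) = a *: crossp u v + crossp u w.
Proof. by apply/rowP => i; rewrite !mxE; ring. Qed.

Lemma crossp0r (u : 'rV[R]_3) : crossp u 0 = 0.
Proof. by apply/rowP => i; rewrite !mxE; ring. Qed.

Lemma mxdot_crossp (u v : 'rV[R]_3) : mxdot (crossp u v) v = 0.
Proof.
rewrite /mxdot big_ord1 !big_ord_recl big_ord0 /crossp !mxE.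
have -> : (ord0 : 'I_3) + 1 = lift ord0 ord0 by apply/val_inj.
have -> : (ord0 : 'I_3) + 2 = lift ord0 (lift ord0 ord0) by apply/val_inj.
have -> : (lift ord0 ord0 : 'I_3) + 1 = lift ord0 (lift ord0 ord0) by apply/val_inj.
have -> : (lift ord0 ord0 : 'I_3) + 2 = ord0 by apply/val_inj.
have -> : (lift ord0 (lift ord0 ord0) : 'I_3) + 1 = ord0 by apply/val_inj.
have -> : (lift ord0 (lift ord0 ord0) : 'I_3) + 2 = lift ord0 ord0 by apply/val_inj.
by ring.
Qed.

(** In the notation [A], [B], [C] of the proof the value is [A^2 + B^2 - (A + B) * C]. Since
    [2 * C <= A + B], it is at least [(A - B)^2 / 2]. *)
Lemma cubic_monotone (a b : 'rV[R]_3) :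
  0 <= mxdot (mxdot a a *: a - mxdot b b *: b) (a - b).
Proof.
rewrite !mxdotE (mxdotC b a).
have := mxdot_ge0 a; have := mxdot_ge0 b.
have : 0 <= mxdot (a - b) (a - b) by exact: mxdot_ge0.
rewrite !mxdotE (mxdotC b a).
set A := mxdot a a; set B := mxdot b b; set C := mxdot a b => h hB hA.
have h1 : (A + B) * (2 * C) <= (A + B) * (A + B).
  by rewrite ler_wpM2l ?addr_ge0//; lra.
have : 0 <= (A - B) ^+ 2 by exact: sqr_ge0.
rewrite sqrrB; nra.
Qed.

End linear_combinations.

(** * Vector space structure and orthonormal bases of the finite element space *)

Section finite_element_space.
Context {R : realType} {d : nat}.
Variables (D : set 'rV[R]_d) (N : nat) (F : 'I_N -> 'rV[R]_d -> 'rV[R]_d) (r : nat).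
Hypotheses (oD : open D) (bD : bounded_set D).
Hypothesis cover : \bigcup_i (F i @` ref_simplex) = closure D.
Local Notation V := (fem_space D F r).
Local Notation vfield := ('rV[R]_d -> 'rV[R]_3).
Implicit Types u v w : vfield.

Lemma poly_deg_leD f g a : poly_deg_le r f -> poly_deg_le r g ->
  @poly_deg_le R d r (fun x => a * f x + g x).
Proof.
move=> [cf hf] [cg hg]; exists (fun t => a * cf t + cg t) => x.
rewrite hf hg mulr_sumr -big_split; apply: eq_bigr => t _.
by rewrite mulrDl mulrA.
Qed.

Lemma femD u v a : V u -> V v -> V (fun x => a *: u x + v x).
Proof.
move=> [Hu cu pu] [Hv cv pv]; split.
- exact: H1D.
- move=> x; apply: cvgD; last exact: cv.
  by apply: cvgZr; exact: cu.
- move=> i c; have [p pp up] := pu i c; have [q qq vq] := pv i c.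
  exists (fun x => a * p x + q x); first exact: poly_deg_leD.
  by move=> x Fx; rewrite !mxE up// vq.
Qed.

(** Zero is the combination [- v + v] of a given element; this is why later lemmas carry a member of
    the space. *)
Lemma fem0 v : V v -> V (fun=> 0).
Proof.
move=> Vv; rewrite (_ : (fun=> 0) = fun x => (-1) *: v x + v x); first exact: femD.
by apply/funext => x; rewrite scaleN1r addNr.
Qed.

Lemma femB u v : V u -> V v -> V (fun x => u x - v x).
Proof.
move=> Vu Vv; rewrite (_ : (fun x => _) = fun x => (-1) *: v x + u x).
  exact: femD.
by apply/funext => x; rewrite scaleN1r addrC.
Qed.

Lemma femZ u a : V u -> V (fun x => a *: u x).
Proof.
move=> Vu; rewrite (_ : (fun x => _) = fun x => a *: u x + 0).
  by apply: femD => //; exact: fem0 Vu.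
by apply/funext => x; rewrite addr0.
Qed.

Lemma fem_comb m (v : 'I_m -> vfield) w a : V w -> (forall i, V (v i)) ->
  V (comb v a).
Proof.
move=> Vw Vv; rewrite /comb; elim: (index_enum _) => [|i s ih].
  by under eq_fun do rewrite big_nil; exact: fem0 Vw.
by under eq_fun do rewrite big_cons; exact: femD.
Qed.

Lemma fem_bounded_measurable v : V v ->
  forall i j, bounded_measurable D (fun x => v x i j).
Proof.
move=> [[sv _] cv _] i j; rewrite ord1; split; first by case: (sv j).
apply: within_continuous_bounded => //; apply/subspace_continuousP => x cx.
have vx := (subspace_continuousP _ _).1 cv x cx.
exact: (cvg_comp _ (fun M : 'rV[R]_3 => M 0 j) vx (@coord_continuous _ _ _ 0 j _)).
Qed.

Lemma fem_H1 v : V v -> H1 D v. Proof. by case. Qed.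

Lemma fem_L2 v : V v -> L2 D v. Proof. by move=> /fem_H1/H1_L2. Qed.

Lemma fem_grad_L2 v : V v -> L2 D (grad D v).
Proof. by move=> /fem_H1; exact: grad_L2. Qed.

Lemma fem_L2inner_eq0 v : V v -> L2inner D v v = 0 ->
  forall x, closure D x -> v x = 0.
Proof. by move=> Vv; apply: L2inner_eq0 => //; [case: Vv|exact: fem_L2]. Qed.

Lemma L2innerZl m n (f h : 'rV[R]_d -> 'M[R]_(m, n)) a : L2 D f -> L2 D h ->
  L2inner D (fun x => a *: f x) h = a * L2inner D f h.
Proof.
move=> Lf Lh; rewrite /L2inner -integral_onZ//; last exact: L2_integrable.
by apply: eq_integral_on => x _; rewrite mxdotZl.
Qed.

Lemma L2innerZB m n (f g h : 'rV[R]_d -> 'M[R]_(m, n)) a :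
  L2 D f -> L2 D g -> L2 D h ->
  L2inner D (fun x => a *: (f x - g x)) h = a * (L2inner D f h - L2inner D g h).
Proof.
move=> Lf Lg Lh.
have Lfg : L2 D (fun x => (-1) *: g x + f x) by exact: L2D.
transitivity (L2inner D (fun x => a *: ((-1) *: g x + f x)) h).
  by apply: eq_L2inner => // x _; rewrite scaleN1r addrC.
by rewrite L2innerZl// L2inner_linl//; ring.
Qed.

Lemma L2innerB m n (f g h : 'rV[R]_d -> 'M[R]_(m, n)) :
  L2 D f -> L2 D g -> L2 D h ->
  L2inner D (fun x => f x - g x) h = L2inner D f h - L2inner D g h.
Proof.
move=> Lf Lg Lh; rewrite -[RHS]mul1r -L2innerZB//.
by apply: eq_L2inner => // x _; rewrite scale1r.
Qed.

Lemma L2inner_gradB u v h : V u -> V v -> L2 D h ->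
  L2inner D (grad D (fun x => u x - v x)) h =
  L2inner D (grad D u) h - L2inner D (grad D v) h.
Proof.
move=> Vu Vv Lh; rewrite (@eq_grad _ _ D _ (fun x => (-1) *: v x + u x)).
  by rewrite L2inner_gradD ?mulN1r 1?addrC//; exact: fem_H1.
by move=> x _; rewrite scaleN1r addrC.
Qed.

Lemma L2inner_grad0 u h : V u -> (forall x, D x -> u x = 0) -> L2 D h ->
  L2inner D (grad D u) h = 0.
Proof.
move=> Vu u0 Lh; rewrite (@eq_grad _ _ D _ (fun x => u x - u x)).
  by rewrite L2inner_gradB// subrr.
by move=> x /u0 ->; rewrite subrr.
Qed.

Lemma L2inner0l m n (f g : 'rV[R]_d -> 'M[R]_(m, n)) :
  (forall x, D x -> f x = 0) -> L2inner D f g = 0.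
Proof.
move=> f0; rewrite /L2inner (@eq_integral_on _ _ D _ (fun=> 0)).
  by rewrite /integral_on /Rintegral integral0.
by move=> x /f0 ->; rewrite mxdot0l.
Qed.

Definition orthonormal m (v : 'I_m -> vfield) :=
  forall i j, L2inner D (v i) (v j) = (i == j)%:R.

Lemma L2inner_comb m (v : 'I_m -> vfield) w : V w -> (forall i, V (v i)) ->
  orthonormal v -> forall a b, L2inner D (comb v a) (comb v b) = mxdot a b.
Proof.
move=> Vw Vv ov a b.
have Lc x := fem_L2 (fem_comb x Vw Vv).
have l1 z : lin (fun x => L2inner D (comb v x) (comb v z)).
  by move=> t x y; rewrite combD L2inner_linl.
have l2 z : lin (fun x => L2inner D (comb v z) (comb v x)).
  by move=> t x y; rewrite combD L2inner_linr.
rewrite (lin_coord a (l1 b)) /mxdot big_ord1; apply: eq_bigr => i _.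
rewrite (lin_coord b (l2 _)) (bigD1 i)//= !comb_delta ov eqxx mulr1.
rewrite big1 ?addr0// => j ji.
by rewrite !comb_delta ov eq_sym (negbTE ji) mulr0.
Qed.

(** An element is given by polynomial coefficients on each cell and component, and the bound counts
    coefficients with every exponent at most [r]. A longer family has a nonzero relation [w] between
    its coefficient rows; the combination vanishes on the closure of [D] because the cells cover it,
    whereas its squared norm is [mxdot w w]. *)
Lemma orthonormal_size m (v : 'I_m -> vfield) : (forall i, V (v i)) ->
  orthonormal v -> (m <= #|{: 'I_N * 'I_3 * {ffun 'I_d -> 'I_r.+1}}|)%N.
Proof.
move=> Vv ov; rewrite leqNgt; apply/negP => mI.
(* The case [m = 0] contradicts [mI]; otherwise [v ord0] serves as the member of the space that
   [L2inner_comb] asks for. *)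
case: m => [|m'] in v Vv ov mI *; first by rewrite ltn0 in mI.
set m := m'.+1 in v Vv ov mI *.
have /choice[c hc] : forall kij : 'I_m * ('I_N * 'I_3),
    exists c : {ffun 'I_d -> 'I_r.+1} -> R,
    forall x, (F kij.2.1 @` ref_simplex) x -> v kij.1 x 0 kij.2.2 =
      \sum_(a : {ffun 'I_d -> 'I_r.+1} | (\sum_i a i <= r)%N)
            c a * \prod_(i < d) x 0 i ^+ a i.
  move=> [k [i j]] /=; have [_ _ /(_ i j)[p [c cp] vp]] := Vv k.
  by exists c => x /vp ->.
pose C : 'M[R]_(m, #|{: 'I_N * 'I_3 * {ffun 'I_d -> 'I_r.+1}}|) :=
  \matrix_(k, t) c (k, (enum_val t).1) (enum_val t).2.
have : kermx C != 0.
  by rewrite kermx_eq0 /row_free neq_ltn (leq_ltn_trans (rank_leq_col C) mI).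
move=> /rowV0Pn[w /sub_kermxP wC w0].
have cw0 x : closure D x -> comb v w x = 0.
  rewrite -cover => -[i _ Fx]; apply/rowP => j.
  rewrite /comb summxE [RHS]mxE.
  under eq_bigr => k _ do rewrite mxE (hc (k, (i, j)) x Fx) mulr_sumr.
  rewrite exchange_big big1//= => a _.
  have /rowP/(_ (enum_rank (i, j, a))) := wC; rewrite !mxE => wCa.
  transitivity ((\sum_k w 0 k * C k (enum_rank (i, j, a))) *
    \prod_(i < d) x 0 i ^+ a i); last by rewrite wCa mul0r.
  rewrite mulr_suml; apply: eq_bigr => k _.
  by rewrite mxE enum_rankK mulrA.
suff : w = 0 by move/eqP; rewrite (negbTE w0).
apply: mxdot_eq0; rewrite -(L2inner_comb (Vv ord0) Vv ov).
transitivity (L2inner D (fun x => comb v w x - comb v w x) (comb v w)).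
  apply: eq_L2inner => // x Dx.
  by rewrite cw0 ?subrr//; exact: subset_closure.
by rewrite L2innerB ?subrr//; apply/fem_L2/(fem_comb _ (Vv ord0)).
Qed.

(** An orthonormal family of maximal size exists by [orthonormal_size]. If the residual [z] of [w]
    after projection had nonzero norm, its normalisation would extend the family. *)
Lemma fem_orthonormal_basis w0 : V w0 -> exists m (v : 'I_m -> vfield),
  [/\ forall i, V (v i), orthonormal v &
      forall w, V w -> exists a, forall x, closure D x -> w x = comb v a x].
Proof.
move=> Vw0.
pose P m := exists2 v : 'I_m -> vfield, forall i, V (v i) & orthonormal v.
have exP : exists m, `[< P m >].
  by exists 0%N; apply/asboolP; exists (fun=> w0) => // -[].
have ubP m : `[< P m >] -> (m <= #|{: 'I_N * 'I_3 * {ffun 'I_d -> 'I_r.+1}}|)%N.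
  by move=> /asboolP[v Vv ov]; exact: orthonormal_size ov.
case: (ex_maxnP exP ubP) => m /asboolP[v Vv ov] maxm.
exists m, v; split=> // w Vw.
pose a : 'rV[R]_m := \row_j L2inner D w (v j).
have Vc := fem_comb a Vw0 Vv.
exists a; pose z x := w x - comb v a x.
have Vz : V z by exact: femB.
have zv j : L2inner D z (v j) = 0.
  rewrite L2innerB; [|exact: fem_L2..].
  rewrite -{2}(comb_delta v j) (L2inner_comb Vw0 Vv ov).
  rewrite /mxdot big_ord1 (bigD1 j)//= !mxE !eqxx mulr1 big1 ?addr0 ?subrr//.
  by move=> i ij; rewrite !mxE eqxx (negbTE ij) mulr0.
have [z0|z0] := eqVneq (L2inner D z z) 0.
  by move=> x cx; apply/eqP; rewrite -subr_eq0; apply/eqP;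
    exact: (fem_L2inner_eq0 Vz z0 cx).
have zpos : 0 < L2inner D z z by rewrite lt_neqAle eq_sym z0 L2inner_ge0.
pose s := (Num.sqrt (L2inner D z z))^-1.
pose z' x := s *: z x.
have z'E g : V g -> L2inner D z' g = s * L2inner D z g.
  by move=> Vg; apply: L2innerZl; exact: fem_L2.
have Vz' : V z' by exact: femZ.
pose v' (i : 'I_m.+1) := if unlift ord_max i is Some j then v j else z'.
suff : `[< P m.+1 >] by move=> /maxm; rewrite ltnn.
apply/asboolP; exists v' => [i|i j]; rewrite /v'.
  by case: unliftP.
case: unliftP => [i'|] ->; case: unliftP => [j'|] ->.
- by rewrite ov (inj_eq lift_inj).
- by rewrite L2innerC z'E// zv mulr0 eq_sym (negbTE (neq_lift _ _)).
- by rewrite z'E// zv mulr0 (negbTE (neq_lift _ _)).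
- rewrite z'E// L2innerC z'E// mulrA -expr2 exprVn sqr_sqrtr ?L2inner_ge0//.
  by rewrite mulVf// eqxx.
Qed.

End finite_element_space.

(** * Time step *)

Section time_step.
Context {R : realType} {d : nat}.
Variables (D : set 'rV[R]_d) (N : nat) (F : 'I_N -> 'rV[R]_d -> 'rV[R]_d) (r : nat).
Hypotheses (oD : open D) (bD : bounded_set D).
Hypothesis cover : \bigcup_i (F i @` ref_simplex) = closure D.
Local Notation V := (fem_space D F r).
Local Notation vfield := ('rV[R]_d -> 'rV[R]_3).
Variables (lambda_r lambda_e kappa mu beta gamma k : R) (e : 'rV[R]_3).
Hypotheses (lr0 : 0 < lambda_r) (le0 : 0 < lambda_e) (kappa0 : 0 < kappa)
  (beta0 : 0 < beta) (k0 : 0 < k).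
Variable un : vfield.
Hypothesis Vun : V un.
Implicit Types u v w f g : vfield.

Local Notation bm f := (forall i j, bounded_measurable D (fun x => f x i j)).

Let bm_mxdot (f g : vfield) : bm f -> bm g ->
  bounded_measurable D (fun x => mxdot (f x) (g x)).
Proof.
move=> bf bg; apply: bounded_measurable_sum => i.
by apply: bounded_measurable_sum => j; exact: bounded_measurableM.
Qed.

Let bm_L2 f : bm f -> L2 D f.
Proof. by move=> bf i j; exact: bounded_measurable_square. Qed.

Let bm_scale (q : 'rV[R]_d -> R) f : bounded_measurable D q -> bm f ->
  bm (fun x => q x *: f x).
Proof.
by move=> bq bf i j; under eq_fun do rewrite mxE; exact: bounded_measurableM.
Qed.

Let bm_fem v : V v -> bm v. Proof. exact: fem_bounded_measurable. Qed.

Let bm_e : bm ((fun=> e) : vfield).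
Proof. by move=> i j; exact: bounded_measurable_cst. Qed.

Let L2_crossp v : V v -> L2 D (fun x => crossp (un x) (v x)).
Proof.
move=> Vv; apply: bm_L2 => i j; rewrite ord1.
rewrite (_ : (fun x => _) = fun x => un x 0 (j + 1) * v x 0 (j + 2) +
    -1 * (un x 0 (j + 2) * v x 0 (j + 1))).
  apply: bounded_measurableD; last apply: bounded_measurableZ.
    by apply: bounded_measurableM; exact: bm_fem.
  by apply: bounded_measurableM; exact: bm_fem.
by apply/funext => x; rewrite mxE mulN1r.
Qed.

Let L2_cubic u v w : V u -> V v -> V w -> L2 D (fun x => mxdot (u x) (v x) *: w x).
Proof.
move=> Vu Vv Vw; apply: bm_L2; apply: (bm_scale (q := fun x => mxdot (u x) (v x))).
  by apply: bm_mxdot; exact: bm_fem.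
exact: bm_fem.
Qed.

Let L2_aniso u : V u -> L2 D (fun x => mxdot e (u x) *: e).
Proof.
move=> Vu; apply: bm_L2; apply: (bm_scale (q := fun x => mxdot e (u x))) => //.
by apply: (bm_mxdot (f := fun=> e)) => //; exact: bm_fem.
Qed.

Local Notation scheme := (scheme_step D V lambda_r lambda_e kappa mu beta gamma e k un).

Lemma scheme_step_unique u H u' H' : V u -> V H -> V u' -> V H' ->
  scheme u H -> scheme u' H' -> forall x, closure D x -> u' x = u x /\ H' x = H x.
Proof.
move=> Vu VH Vu' VH' [eq1 eq2] [eq1' eq2'].
pose du x := u' x - u x; pose dH x := H' x - H x.
have Vdu : V du by exact: femB.
have VdH : V dH by exact: femB.
have [Lu LH Lu' LH' Lun] := And5 (fem_L2 Vu) (fem_L2 VH) (fem_L2 Vu')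
  (fem_L2 VH') (fem_L2 Vun).
have E1 chi : V chi -> k^-1 * L2inner D du chi = lambda_r * L2inner D dH chi +
    lambda_e * L2inner D (grad D dH) (grad D chi) -
    gamma * L2inner D (fun x => crossp (un x) (dH x)) chi.
  move=> Vchi; have Lc := fem_L2 Vchi; have Lgc := fem_grad_L2 Vchi.
  have := eq1 _ Vchi; have := eq1' _ Vchi.
  have duE : L2inner D du chi = _ := L2innerB oD Lu' Lu Lc.
  have dHE : L2inner D dH chi = _ := L2innerB oD LH' LH Lc.
  have gHE : L2inner D (grad D dH) (grad D chi) = _ :=
    L2inner_gradB oD bD VH' VH Lgc.
  rewrite (L2innerZB oD _ Lu' Lun Lc) (L2innerZB oD _ Lu Lun Lc).
  rewrite duE dHE gHE {duE dHE gHE}.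
  have -> : L2inner D (fun x => crossp (un x) (dH x)) chi =
      L2inner D (fun x => crossp (un x) (H' x)) chi -
      L2inner D (fun x => crossp (un x) (H x)) chi.
    rewrite -(L2innerB oD (L2_crossp VH') (L2_crossp VH) Lc).
    apply: eq_L2inner => // x _.
    by rewrite /dH -[H' x - H x]addrC -scaleN1r crosspDr scaleN1r addrC.
  move: (L2inner D u' chi) (L2inner D u chi) (L2inner D un chi)
    (L2inner D H' chi) (L2inner D H chi) (L2inner D (grad D H') _)
    (L2inner D (grad D H) _) (L2inner D (fun x => crossp (un x) (H' x)) chi)
    (L2inner D (fun x => crossp (un x) (H x)) chi) => a1 a2 a3 a4 a5 a6 a7 a8 a9.
  rewrite !mulrBr => h1 h2; lra.
(* The difference of the two cubic terms is kept as one field, to which [cubic_monotone] applies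
   pointwise. *)
have E2 phi : V phi -> L2inner D dH phi = - L2inner D (grad D du) (grad D phi)
    - kappa * L2inner D (fun x => mxdot (u' x) (u' x) *: u' x -
                                  mxdot (u x) (u x) *: u x) phi
    - beta * L2inner D (fun x => mxdot e (du x) *: e) phi.
  move=> Vphi; have Lc := fem_L2 Vphi; have Lgc := fem_grad_L2 Vphi.
  have := eq2 _ Vphi; have := eq2' _ Vphi.
  have dHE : L2inner D dH phi = _ := L2innerB oD LH' LH Lc.
  have guE : L2inner D (grad D du) (grad D phi) = _ :=
    L2inner_gradB oD bD Vu' Vu Lgc.
  rewrite dHE guE {dHE guE} (L2innerB oD (L2_cubic Vu' Vu' Vu') (L2_cubic Vu Vu Vu) Lc).
  have -> : L2inner D (fun x => mxdot e (du x) *: e) phi =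
      L2inner D (fun x => mxdot e (u' x) *: e) phi -
      L2inner D (fun x => mxdot e (u x) *: e) phi.
    rewrite -(L2innerB oD (L2_aniso Vu') (L2_aniso Vu) Lc).
    apply: eq_L2inner => // x _.
    by rewrite /du mxdotBr scalerBl.
  move: (L2inner D H' phi) (L2inner D H phi) (L2inner D (grad D u') _)
    (L2inner D (grad D u) _) (L2inner D un phi)
    (L2inner D (fun x => mxdot (u' x) (u' x) *: u' x) phi)
    (L2inner D (fun x => mxdot (u x) (u x) *: u x) phi)
    (L2inner D (fun x => mxdot e (u' x) *: e) phi)
    (L2inner D (fun x => mxdot e (u x) *: e) phi)
    => a1 a2 a3 a4 a5 a6 a7 a8 a9 h1 h2.
  rewrite !mulrBr; lra.
(* For [phi = du] all three terms on the right of [E2] are nonpositive. *)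
have dH_le0 : L2inner D du dH <= 0.
  rewrite L2innerC E2//.
  have h1 : 0 <= L2inner D (grad D du) (grad D du) by exact: L2inner_ge0.
  have h2 : 0 <= L2inner D (fun x => mxdot (u' x) (u' x) *: u' x -
                                  mxdot (u x) (u x) *: u x) du.
    by apply: Rintegral_ge0 => t _; exact: cubic_monotone.
  have h3 : 0 <= L2inner D (fun x => mxdot e (du x) *: e) du.
    by apply: Rintegral_ge0 => t _; rewrite mxdotZl -expr2 sqr_ge0.
  have := mulr_ge0 (ltW kappa0) h2; have := mulr_ge0 (ltW beta0) h3.
  by move=> h5 h4; rewrite -!opprD oppr_le0 !addr_ge0.
(* For [chi = dH] the cross product term vanishes pointwise, and [lambda_r] times the squared norm
   of [dH] is at most [k^-1 * L2inner D du dH], which is nonpositive. *)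
have dH0 x : closure D x -> dH x = 0.
  apply: (fem_L2inner_eq0 oD VdH).
  have := E1 _ VdH.
  rewrite (_ : L2inner D (fun x => crossp (un x) (dH x)) dH = 0); last first.
    rewrite /L2inner (@eq_integral_on _ _ D _ (fun=> 0)).
      by rewrite /integral_on /Rintegral integral0.
    by move=> y _; exact: mxdot_crossp.
  have h1 := L2inner_ge0 D dH; have h2 := L2inner_ge0 D (grad D dH).
  have h3 := mulr_ge0 (ltW le0) h2.
  have h4 : k^-1 * L2inner D du dH <= 0 by rewrite pmulr_rle0 ?invr_gt0.
  move=> E; apply/eqP; rewrite eq_le h1 andbT -(pmulr_rle0 _ lr0).
  move: E h3 h4; rewrite mulr0 subr0 => -> h3 h4.
  by apply: le_trans h4; rewrite lerDl.
have dHD x : D x -> dH x = 0 by move=> Dx; exact/dH0/subset_closure.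
(* Once [dH] vanishes on [D], the first equation with [chi = du] reduces to
   [k^-1 * L2inner D du du = 0]. *)
have du0 x : closure D x -> du x = 0.
  apply: (fem_L2inner_eq0 oD Vdu).
  have := E1 _ Vdu.
  rewrite (L2inner_grad0 oD bD VdH dHD (fem_grad_L2 Vdu)).
  rewrite (L2inner0l _ dHD) (L2inner0l (f := fun x => crossp (un x) (dH x))).
    move=> E; have : k^-1 * L2inner D du du = 0 by rewrite E !mulr0 addr0 subr0.
    by move/eqP; rewrite mulf_eq0 invr_eq0 gt_eqF//= => /eqP.
  by move=> y /dHD ->; exact: crossp0r.
by move=> x cx; split; apply/eqP; rewrite -subr_eq0; apply/eqP; [exact: du0|exact: dH0].
Qed.

(** In an orthonormal basis the inner product becomes [mxdot], and the terms of the scheme become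
    forms satisfying the hypotheses of [nonlinear_system_solvable]. The previous step [un] is not
    expanded in the basis; it enters through [l0] and [c]. *)
Lemma scheme_step_exists : exists u H, [/\ V u, V H & scheme u H].
Proof.
have [m [v [Vv ov span]]] := fem_orthonormal_basis oD bD cover Vun.
have Vc a : V (comb v a) by exact: (fem_comb oD bD _ Vun).
have Lc a := fem_L2 (Vc a).
have Lgc a := fem_grad_L2 (Vc a).
pose s a b := L2inner D (grad D (comb v a)) (grad D (comb v b)).
pose c a b := L2inner D (fun x => crossp (un x) (comb v a x)) (comb v b).
pose q a b := L2inner D (fun x => mxdot e (comb v a x) *: e) (comb v b).
pose tau a1 a2 a3 a4 := L2inner D
  (fun x => mxdot (comb v a1 x) (comb v a2 x) *: comb v a3 x) (comb v a4).
pose l0 a := L2inner D un (comb v a).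
have dotE a b : mxdot a b = L2inner D (comb v a) (comb v b).
  by rewrite (L2inner_comb oD bD Vun Vv ov).
have bs : bilin s.
  split=> z t a b; rewrite /s combD.
    by rewrite (L2inner_gradD oD bD)//; exact: fem_H1.
  rewrite !(L2innerC D (grad D (comb v z))).
  by rewrite (L2inner_gradD oD bD)//; exact: fem_H1.
have bc : bilin c.
  split=> z t a b; rewrite /c; last first.
    by rewrite combD (L2inner_linr oD)//; exact: L2_crossp.
  rewrite -(L2inner_linl oD)//; [|exact: L2_crossp|exact: L2_crossp].
  by apply: eq_L2inner => // x _; rewrite combD crosspDr.
have bq : bilin q.
  split=> z t a b; rewrite /q; last by rewrite combD (L2inner_linr oD)//; exact: L2_aniso.
  rewrite -(L2inner_linl oD)//; [|exact: L2_aniso|exact: L2_aniso].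
  by apply: eq_L2inner => // x _; rewrite combD mxdotDr mxdotZr scalerDl scalerA.
have ll0 : lin l0.
  by move=> t a b; rewrite /l0 combD (L2inner_linr oD _ (Lc a) (Lc b) (fem_L2 Vun)).
have Lt a1 a2 a3 : L2 D (fun x => mxdot (comb v a1 x) (comb v a2 x) *: comb v a3 x).
  exact: L2_cubic.
have t1 y z (w : 'rV[R]_m) : lin (fun x => tau x y z w).
  move=> t a b; rewrite /tau -(L2inner_linl oD)//.
  by apply: eq_L2inner => // x _; rewrite combD mxdotDl mxdotZl scalerDl scalerA.
have tC x y z (w : 'rV[R]_m) : tau x y z w = tau y x z w.
  by apply: eq_L2inner => // p _; rewrite mxdotC.
have t2 x z (w : 'rV[R]_m) : lin (fun y => tau x y z w).
  by move=> t a b; rewrite tC t1 !(tC x).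
have t3 x y (w : 'rV[R]_m) : lin (fun z => tau x y z w).
  move=> t a b; rewrite /tau -(L2inner_linl oD)//.
  apply: eq_L2inner => // p _; rewrite combD scalerDr !scalerA.
  by rewrite (mulrC t).
have t4 x y z : lin (tau x y z).
  by move=> t a b; rewrite /tau combD (L2inner_linr oD).
(* The constant [K] is the measure of [D]: with [z] the squared length of the field, integrating
   [2 * z - 1 <= z ^+ 2] gives the coercivity of [tau]. *)
have [|||||||a [b [e1 e2]]] := @nonlinear_system_solvable R m k lambda_r lambda_e
  kappa mu beta gamma (integral_on D (fun=> 1)) k0 lr0 le0 kappa0 beta0
  s c q tau l0 bs bc bq ll0 t1 t2 t3 t4.
- by move=> x; exact: L2inner_ge0.
- move=> x; rewrite /c /L2inner (@eq_integral_on _ _ D _ (fun=> 0)).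
    by rewrite /integral_on /Rintegral integral0.
  by move=> y _; exact: mxdot_crossp.
- by move=> x; apply: Rintegral_ge0 => t _; rewrite mxdotZl -expr2 sqr_ge0.
- exact: tC.
- by move=> x y; apply: Rintegral_ge0 => t _; rewrite mxdotZl mulr_ge0// mxdot_ge0.
- by move=> x y; apply: Rintegral_ge0 => t _; rewrite mxdotZl -expr2 sqr_ge0.
- move=> x; rewrite dotE.
  have i1 : integrable_on D (fun=> 1).
    by apply: bounded_measurable_integrable => //; exact: bounded_measurable_cst.
  have i2 := L2_integrable oD (Lc x) (Lc x).
  have i3 := integrable_onZ oD 2 i2.
  have i4 := integrable_onZ oD (-1) i1.
  rewrite -(integral_onZ oD 2 i2) -mulN1r -(integral_onZ oD (-1) i1).
  rewrite -(integral_onD oD i3 i4).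
  apply: le_Rintegral; first exact: measurable_open_preimage.
  - exact: (integrable_onD oD i3 i4).
  - exact: (L2_integrable oD (Lt x x x) (Lc x)).
  - move=> t _; rewrite mxdotZl mulr1.
    set z := mxdot _ _; have : 0 <= (z - 1) ^+ 2 by exact: sqr_ge0.
    by rewrite sqrrB; lra.
exists (comb v a), (comb v b); split=> //.
(* A test field agrees with a combination of the basis only on the closure of [D], so the equations
   are transferred by their invariance under changes off [D]. *)
have ext (G : vfield -> Prop) :
    (forall z, G (comb v z)) ->
    (forall f g, (forall x, D x -> f x = g x) -> G f -> G g) ->
    forall chi, V chi -> G chi.
  move=> Gc Gext chi /span[z hz]; apply: Gext (Gc z) => x Dx.
  by rewrite hz//; exact: subset_closure.
have fgE (f g : vfield) : (forall x, D x -> f x = g x) ->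
    forall h, L2inner D h f = L2inner D h g.
  by move=> fg h; exact: eq_L2inner.
split.
  apply: (ext) => [z|f g fg]; last first.
    by rewrite (eq_grad fg) !(fgE f g fg).
  rewrite (L2innerZB oD _ (Lc a) (fem_L2 Vun) (Lc z)).
  by have := e1 z; rewrite !dotE.
apply: ext => [z|f g fg]; last first.
  by rewrite (eq_grad fg) !(fgE f g fg).
by have := e2 z; rewrite !dotE.
Qed.

End time_step.

Theorem proposition4p1 (R : realType) (d : nat) (hd : (1 <= d <= 3)%N)
  (D : set 'rV[R]_d) (hD : bounded_domain D)
  (hDreg : smooth_boundary D \/ convex_polyhedral D)
  (lambda_r lambda_e kappa mu beta gamma : R)
  (hlambda_r : 0 < lambda_r) (hlambda_e : 0 < lambda_e)
  (hkappa : 0 < kappa) (hmu : 0 < mu) (hbeta : 0 < beta)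
  (e : 'rV[R]_3) (he : mxdot e e = 1)
  (N : nat) (F : 'I_N -> 'rV[R]_d -> 'rV[R]_d) (hF : triangulation D F)
  (r : nat) (hr : (1 <= r)%N)
  (k : R) (hk : 0 < k)
  (uh : nat -> 'rV[R]_d -> 'rV[R]_3) (hu0 : fem_space D F r (uh 0%N)) :
  forall n : nat, fem_space D F r (uh n) ->
  exists u H : 'rV[R]_d -> 'rV[R]_3,
    [/\ fem_space D F r u, fem_space D F r H,
        scheme_step D (fem_space D F r)
          lambda_r lambda_e kappa mu beta gamma e k (uh n) u H &
        forall u' H' : 'rV[R]_d -> 'rV[R]_3,
          fem_space D F r u' -> fem_space D F r H' ->
          scheme_step D (fem_space D F r)
            lambda_r lambda_e kappa mu beta gamma e k (uh n) u' H' ->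
          forall x, closure D x -> u' x = u x /\ H' x = H x].
Proof.
move=> n Vn; case: hD => oD _ bD _; case: hF => _ _ cover _.
have [u [H [Vu VH uH]]] : exists u H, [/\ fem_space D F r u, fem_space D F r H &
    scheme_step D (fem_space D F r)
      lambda_r lambda_e kappa mu beta gamma e k (uh n) u H].
  exact: scheme_step_exists.
exists u, H; split=> // u' H' Vu' VH'.
exact: (scheme_step_unique oD bD).
Qed.
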